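(* Consider the nonhomogeneous frog model on $\mathbb{Z}$ with frog counts $(X_j)_{j\ge 1}$ and left-step probabilities $(p_j)_{j\ge 0}$. Suppose that the $X_j$ are i.i.d. with $\mathbb{E}[X_1]<\infty$, that $p_j=\frac12+a_j$ where $g(j)=\frac{1}{a_j}$ is concave in $j$, and let $d=\min\{j:\mathbb{P}(X_1=j)>0\}$. Let $f(s)=\mathbb{E}[s^{X_1}]$ be the common probability generating function of the $X_j$, and let $$\mathcal{K}=-\int_0^{\infty}\log\left[f(1-e^{-x})\right]dx .$$ Then the model is transient if and only if $$\sum_{n=1}^{\infty}\frac{e^{-\frac{\mathcal{K}}{4a_n}}}{(a_n)^{d/2}}=\infty .$$
   Context: The nonhomogeneous frog model on $\mathbb{Z}$ is the following discrete-time system of interacting random walks. At time $0$ there is one active frog at the origin $0$, no frogs at negative integers, and $X_j$ sleeping frogs at $x=j$ for each $j\ge 1$. The $X_j$ are independent random variables with values in $\{0,1,2,\dots\}$, with $\mathbb{P}(X_j\ge 1)>0$ for every $j$, and $X_{j+1}\succeq X_j$ for all $j\ge 1$, where $\succeq$ denotes stochastic dominance (i.e. $\mathbb{P}(X_{j+1}\ge k)\ge \mathbb{P}(X_j\ge k)$ for all $k$; this is automatic when the $X_j$ are i.i.d.). An active frog performs a nearest-neighbor random walk on $\mathbb{Z}$; a sleeping frog stays put until an active frog lands on its vertex, at which moment all sleeping frogs at that vertex become active and begin their own random walks. Each frog originating at $x=j$ ($j\ge 0$), once active, at each step goes left with probability $p_j$ and right with probability $1-p_j$, where $\frac12<p_j<1$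 for all $j\ge 0$ and the sequence $(p_j)_{j\ge 1}$ is decreasing in the weak sense ($p_{j+1}\le p_j$). All random walks are mutually independent and independent of the $X_j$. The model is called transient if the probability that infinitely many distinct frogs hit the origin is $0$; otherwise it is non-transient. A sequence $(g(j))_{j\ge 1}$ is concave if $g(j+1)-g(j)$ is non-increasing in $j$. *)

(* Defs.v *)
From HB Require Import structures.
From mathcomp Require Import all_boot all_order all_algebra.
From mathcomp Require Import all_classical all_reals all_analysis.
Set Implicit Arguments.
Unset Strict Implicit.
Unset Printing Implicit Defensive.
Import Order.TTheory GRing.Theory Num.Theory.
Import numFieldNormedType.Exports.
Local Open Scope classical_set_scope.
Local Open Scope ring_scope.

(* The evolution for one outcome of the randomness.  Frog (j, i) is the i-th of
   the x j frogs originating at site j; left j i n tells whether its n-th step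
   after its own activation goes left. *)
Section dynamics.
Variables (x : nat -> nat) (left : nat -> nat -> nat -> bool).

Definition frog_walk (j i k : nat) : int :=
  j%:Z + \sum_(m < k) (if left j i m then -1 else 1).

(* At time t, [age t j] is None if site j has not been visited yet, and Some k
   if it was first visited at time t - k, so that the frogs originating at j
   have made k steps.  A site with x j = 0 also gets an age, but no frog moves
   from it.  Only active frogs visit sites; they make step k.+1 between times t
   and t.+1, and frogs woken at time t.+1 make their first step after that. *)
Fixpoint age (t j : nat) : option nat :=
  match t with
  | 0%N => if j == 0%N then Some 0%N else None
  | t'.+1 =>
    match age t' j with
    | Some k => Some k.+1
    | None =>
      if `[< exists l i k, [/\ (i < x l)%N, age t' l = Some k
                             & frog_walk l i k.+1 = j%:Z] >]
      then Some 0%N else None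
    end
  end.

Definition hits_origin (f : nat * nat) : Prop :=
  (f.2 < x f.1)%N /\
  exists t k, age t f.1 = Some k /\ frog_walk f.1 f.2 k = 0.

End dynamics.

Section probability_notions.
Context (d : measure_display) (T : measurableType d) (R : realType)
  (P : probability T R).

Definition mutually_independent (I : eqType) (F : I -> set (set T)) : Prop :=
  forall (s : seq I) (A : I -> set T), uniq s ->
    (forall i, i \in s -> F i (A i)) ->
    P (\big[setI/setT]_(i <- s) A i) = (\prod_(i <- s) P (A i))%E.

Definition sigma_of (d' : measure_display) (T' : measurableType d')
    (Y : {RV P >-> T'}) : set (set T) :=
  preimage_set_system setT Y measurable.

Definition stochastically_dominates (Y Z : {RV P >-> nat}) : Prop :=
  forall k : nat,
    (P [set w | (k <= Z w)%N] <= P [set w | (k <= Y w)%N])%E.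

Definition pgf (Y : {RV P >-> nat}) (s : R) : R :=
  fine 'E_P[fun w => s ^+ Y w].

End probability_notions.

Section frog_model.
Context (d : measure_display) (T : measurableType d) (R : realType)
  (P : probability T R).
Variables (X : nat -> {RV P >-> nat})
  (left : nat -> nat -> nat -> {RV P >-> bool}) (p : nat -> R).

Definition source : eqType := (nat + nat * nat * nat)%type.

Definition source_sigma (e : source) : set (set T) :=
  match e with
  | inl j => sigma_of (X j)
  | inr (j, i, n) => sigma_of (left j i n)
  end.

(* Step variables are provided for every pair (j, i), but only those with
   i < X j belong to a frog; X 0 = 1 encodes the initially active frog. *)
Record nonhomogeneous_frog_model : Prop := NonhomogeneousFrogModel {
  one_frog_at_origin : forall w, X 0%N w = 1%N;
  frogs_possible : forall j, (1 <= j)%N -> (0 < P [set w | (1 <= X j w)%N])%E;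
  counts_increasing : forall j, (1 <= j)%N ->
    stochastically_dominates (X j.+1) (X j);
  left_drift : forall j, 2^-1 < p j < 1;
  drift_decreasing : forall j, (1 <= j)%N -> p j.+1 <= p j;
  left_prob : forall j i n, P [set w | left j i n w = true] = (p j)%:E;
  sources_independent : mutually_independent P source_sigma
}.

Definition infinitely_many_hit_origin : set T :=
  [set w | infinite_set [set f : nat * nat |
     hits_origin (fun j => X j w) (fun j i n => left j i n w) f]].

Definition transient : Prop := P infinitely_many_hit_origin = 0%E.

End frog_model.

Definition concave_seq (R : realType) (g : nat -> R) : Prop :=
  forall j, (1 <= j)%N -> g j.+2 - g j.+1 <= g j.+1 - g j.

(* The endpoint 0 is left out because [ln 0 = 0] and the generating function
   may vanish there; it does not affect the integral. *)
Definition frog_K (d : measure_display) (T : measurableType d) (R : realType)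
    (P : probability T R) (Y : {RV P >-> nat}) : R :=
  - \int[lebesgue_measure]_(x in `]0%R, +oo[) ln (pgf Y (1 - expR (- x))).

(* Main.v *)
Require Import Defs.
From HB Require Import structures.
From mathcomp Require Import all_boot all_order all_algebra.
From mathcomp Require Import all_classical all_reals all_analysis.
From mathcomp Require Import measurable_realfun.
From mathcomp Require Import zify ring lra.
Set Implicit Arguments.
Unset Strict Implicit.
Unset Printing Implicit Defensive.
Import Order.TTheory GRing.Theory Num.Theory.
Import numFieldNormedType.Exports.
Local Open Scope classical_set_scope.
Local Open Scope ring_scope.

(** Every frog drifts to the left, so almost surely every woken frog comes back
to the origin, and infinitely many frogs hit the origin exactly when every
positive site gets visited.  Site m is never visited if no frog starting on the
left of m would reach m; call this a gap at m.  A frog from l reaches m with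
probability r_l^(m - l), where r_l = (1 - p_l) / p_l (gambler's ruin,
[reach_prob_down]), so that by independence the frogs of the sites n, ..., n + k - 1
all miss n + k with probability [gap_prob n k], the product over i < k of
f (1 - r_(n+i)^(k-i)) ([prob_gap]).

The model is transient iff the series of the numbers [gap_prob 1 k] diverges
([transient_iff_gap_sum]).  If the series converges, let N be such that the
remainder after N is small; with positive probability frog 0 alone reaches
N + 1, and given this a gap beyond N + 1 has probability at most 1/2
([never_gap_pos]).  For the converse, what happens beyond a first gap at m
depends only on the frogs from m on, which have less drift than those from 1 on,
so that P(gap at n) is at most the sum over m of P(first gap at m) times
[gap_prob 1 (n - m)].  Summing over n shows that a positive probability of no gap
bounds the series ([gap_sum_bounded]).

It remains to compare the two series.  Write r_l = exp (- lam_l) and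
H(x) = - ln f (1 - exp (- x)); then - ln (gap_prob 1 k) is the sum over
1 <= i <= k of H (i lam_(k+1-i)) ([exponent]).  For a constant lam, this sum is a
Riemann sum of H, of total integral K.  As f s = s^d phi s with phi bounded away
from 0, H is the sum of a bounded decreasing function and of d times the convex
function L(x) = - ln (1 - exp (- x)), which is close to - ln x near 0.  The midpoint
and the trapezoid rule for convex functions then give K / lam + (d / 2) ln lam up
to a bounded error ([sum_logpgf_le], [sum_logpgf_ge]).  As lam_n is
4 a_n up to a term of order a_n^2, the n-th term of the series of the theorem is,
up to a bounded factor, exp (- K / lam_n - (d / 2) ln lam_n).

Replacing all the lam_j by the smallest one, lam_n, only increases the sum of H,
which bounds the terms of that series by a multiple of the gap probabilities
([model_term_le]).  For the converse bound, let q be the integral part of the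
fourth root of n.  If 1 / a_n <= q + 1, only the q^2 sites before n matter, and over
this window concavity of 1 / a makes the relative variation of a at most
2 / q^2, which changes the sum by a bounded amount
([exponent_ge_slow]).  Otherwise the drift near n is so weak that the q sites
before n already make the gap probability exponentially small in q, hence
O(1 / n^2) ([exponent_ge_fast]).  So each gap probability is at most a constant
times the term of the series plus 1 / n^2 ([exponent_bound]). *)

(** * Deterministic dynamics: visited sites and unreached sites *)

(** Recursion on the first step: this form turns the law of the hitting time into a
recursion on its time and level ([climb_prob]). *)
Fixpoint climbs (up : nat -> bool) (t k : nat) : bool :=
  match k, t with
  | 0, _ => true
  | _.+1, 0 => false
  | k'.+1, t'.+1 => climbs (fun n => up n.+1) t' (if up 0%N then k' else k'.+2)
  end.

Lemma climbsP (up : nat -> bool) (t k : nat) :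
  climbs up t k <->
  exists2 u, (u <= t)%N & \sum_(m < u) (if up m then 1 else -1) = k%:Z :> int.
Proof.
elim: t up k => [|t IH] up [|k] /=.
- by split=> // _; exists 0%N => //; rewrite big_ord0.
- by split=> // -[[|u]] //; rewrite big_ord0.
- by split=> // _; exists 0%N => //; rewrite big_ord0.
rewrite IH; split=> [[u ut E]|[[|u] ut]].
- exists u.+1 => //; rewrite big_ord_recl /=.
  under eq_bigr do rewrite /bump /= add1n.
  by rewrite E; case: (up 0%N); lia.
- by rewrite big_ord0.
rewrite big_ord_recl /= => E; exists u => //.
move: E; under eq_bigr do rewrite /bump /= add1n.
by case: (up 0%N); lia.
Qed.

Lemma eq_climbs (f g : nat -> bool) t k : f =1 g -> climbs f t k = climbs g t k.
Proof.
elim: t f g k => [|t IH] f g [|k] //= fg.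
by rewrite fg; apply: IH => n; exact: fg.
Qed.

Lemma climbs_mono (up : nat -> bool) (s t k : nat) :
  (s <= t)%N -> climbs up s k -> climbs up t k.
Proof. by move=> st /climbsP[u us E]; apply/climbsP; exists u => //; exact: leq_trans us st. Qed.

(** Since finite sequences over a countable type are countable, this presents
infinitude as a countable intersection, which serves measurability. *)
Lemma infinite_setP_seq (I : eqType) (A : set I) :
  infinite_set A <-> forall s : seq I, exists2 f, A f & f \notin s.
Proof.
split=> [inf s|H /finite_seqP[s As]].
  apply: contrapT => H; apply: inf.
  apply: (@sub_finite_set _ _ [set` s]) => [f Af|]; last exact: finite_seq.
  by apply: contrapT => /negP fs; apply: H; exists f.
by have [f] := H s; rewrite As /= => ->.
Qed.

Section dynamics_facts.
Variables (x : nat -> nat) (left : nat -> nat -> nat -> bool).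

(** The frogs of site [l] are followed on their own clocks, as if they were awake
from the start: which sites they reach does not depend on when they wake up. *)
Definition reaches (l n : nat) : Prop :=
  exists2 i, (i < x l)%N & exists u, frog_walk left l i u = n%:Z.

Definition unreached (n m : nat) : Prop :=
  forall l, (n <= l < m)%N -> ~ reaches l m.

Lemma frog_walkS l i u : frog_walk left l i u.+1 =
  frog_walk left l i u + (if left l i u then -1 else 1).
Proof. by rewrite /frog_walk big_ord_recr /= addrA. Qed.

(** Steps have size one, so a walk cannot jump over a site. *)
Lemma frog_walk_ivt l i u (n : nat) : (l <= n)%N -> n%:Z <= frog_walk left l i u ->
  exists2 v, (v <= u)%N & frog_walk left l i v = n%:Z.
Proof.
move=> ln; elim: u => [|u IH].
  rewrite /frog_walk big_ord0 addr0 => nl; exists 0%N => //.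
  by rewrite big_ord0 addr0; lia.
case: (lerP n%:Z (frog_walk left l i u)) => [/IH[v vu E] _|lt].
  by exists v => //; exact: leqW.
rewrite frog_walkS => ge; exists u.+1 => //; rewrite frog_walkS.
by move: ge; case: (left l i u); lia.
Qed.

Lemma reaches_le l m n : (l <= m <= n)%N -> reaches l n -> reaches l m.
Proof.
move=> /andP[lm mn] [i ix [u E]]; exists i => //.
have [|v _ Ev] := @frog_walk_ivt l i u m lm; first by rewrite E; lia.
by exists v.
Qed.

Lemma unreached_le k n m : (k <= n)%N -> unreached k m -> unreached n m.
Proof. by move=> kn U l /andP[nl lm]; apply: U; rewrite (leq_trans kn nl). Qed.

(** If the frogs from [k] to [n - 1] all miss [n], they miss every later site as well,
so only the frogs from [n] on can prevent a gap further right. *)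
Lemma unreached_split k n m : (k <= n <= m)%N ->
  unreached k n -> (unreached k m <-> unreached n m).
Proof.
move=> /andP[kn nm] Ukn; split=> [|Unm l /andP[kl lm]]; first exact: unreached_le.
case: (leqP n l) => [nl|ln]; first by apply: Unm; rewrite nl.
move=> rm; apply: (Ukn l); first by rewrite kl.
by apply: (reaches_le _ rm); rewrite (ltnW ln).
Qed.

Lemma age_shift t j k s : age x left t j = Some k -> age x left (s + t) j = Some (s + k)%N.
Proof. by move=> E; elim: s => [|s /= ->]. Qed.

Lemma age_woken t j k : age x left t j = Some k ->
  exists t0, age x left t0 j = Some 0%N.
Proof.
elim: t k => [|t IH] k /=.
  by case: eqP => // -> _; exists 0%N.
case E: (age x left t j) => [k'|]; first by move=> _; exact: IH E.
case: asboolP => // wk _; exists t.+1; rewrite /= E.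
by case: asboolP.
Qed.

Definition visited (j : nat) : Prop := exists t k, age x left t j = Some k.

Lemma visited_age j : visited j -> exists t, forall s, age x left (s + t) j = Some s.
Proof.
move=> [t [k /age_woken[t0 E]]]; exists t0 => s.
by rewrite (age_shift s E) addn0.
Qed.

Lemma visited0 : visited 0.
Proof. by exists 0%N, 0%N. Qed.

Lemma visited_reaches l n : visited l -> reaches l n -> (l < n)%N -> visited n.
Proof.
move=> /visited_age[t vl] [i ix [u E]] ln.
case: u E => [|u] E.
  by move: E ln; rewrite /frog_walk big_ord0 addr0 => -[->]; rewrite ltnn.
have vt := vl u.
case En: (age x left (u + t) n) => [k|]; first by exists (u + t)%N, k.
exists (u + t).+1, 0%N; rewrite /= En; case: asboolP => // -[].
by exists l, i, u.
Qed.

(** A woken site has been reached through a chain of frogs, each of which covers all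
the sites between its origin and its target. *)
Lemma age_reached t n k : age x left t n = Some k ->
  forall m, (0 < m <= n)%N -> ~ unreached 0 m.
Proof.
elim: t n k => [|t IH] n k /=.
  by case: eqP => // -> _ m /andP[m0]; rewrite leqn0 => /eqP me; move: m0; rewrite me.
case E: (age x left t n) => [k'|]; first by move=> _; exact: IH E.
case: asboolP => // -[l [i [u [ix El Ew]]]] _ m /andP[m0 mn].
case: (leqP m l) => [ml|lm]; first by apply: (IH l u El); rewrite m0.
move=> /(_ l); apply=> //; apply: (@reaches_le l m n); first by rewrite (ltnW lm).
by exists i => //; exists u.+1.
Qed.

(** Whether a site is visited is thus expressed without any reference to time. *)
Lemma visited_iff n : visited n <-> forall m, (0 < m <= n)%N -> ~ unreached 0 m.
Proof.
split=> [[t [k]]|]; first exact: age_reached.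
elim/ltn_ind: n => n IH Cn.
case: (posnP n) => [->|n0]; first exact: visited0.
have /existsNP[l /not_implyP[/andP[_ ln] /contrapT rn]] : ~ unreached 0 n.
  by apply: Cn; rewrite n0 /=.
apply: (visited_reaches _ rn ln); apply: IH => // m /andP[m0 ml]; apply: Cn.
by rewrite m0 (leq_trans ml (ltnW ln)).
Qed.

(** A gap at [m] confines the woken frogs to the sites below [m], of which there are
finitely many. *)
Lemma infinite_hits_reached :
  infinite_set [set f : nat * nat | hits_origin x left f] ->
  forall m, (0 < m)%N -> ~ unreached 0 m.
Proof.
move=> inf m m0 Um; apply: inf.
have sub : [set f : nat * nat | hits_origin x left f] `<=`
   \bigcup_(j in `I_m) (pair j @` `I_(x j)).
  move=> [j i] [/= ix [t [k [E _]]]]; exists j; last by exists i.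
  rewrite /= ltnNge; apply/negP => mj; apply: (age_reached E) Um; exact/andP.
apply: (sub_finite_set sub); apply: bigcup_finite; first exact: finite_II.
by move=> j _; apply: finite_image; exact: finite_II.
Qed.

Lemma reached_infinite_hits :
  (forall m, (0 < m)%N -> ~ unreached 0 m) ->
  (forall j i, exists u, frog_walk left j i u = 0) ->
  (forall n, exists2 j, (n <= j)%N & (0 < x j)%N) ->
  infinite_set [set f : nat * nat | hits_origin x left f].
Proof.
move=> C ret many; apply/infinite_setP_seq => s.
have [j sj xj] := many (\max_(f <- s) f.1).+1.
exists (j, 0%N); last first.
  apply/negP => js; move: sj; rewrite ltnNge => /negP; apply.
  by rewrite (big_rem _ js) /= leq_maxl.
split=> //=; have [u Eu] := ret j 0%N.
have /visited_age[t vj] : visited j by apply/visited_iff => m /andP[m0 _]; exact: C.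
by exists (u + t)%N, u.
Qed.
End dynamics_facts.

(** * Gambler's ruin *)

Section gambler.
Context {R : realType}.

Fixpoint climb_prob (al : R) (t k : nat) : R :=
  match k, t with
  | 0, _ => 1
  | _.+1, 0 => 0
  | k'.+1, t'.+1 => al * climb_prob al t' k' + (1 - al) * climb_prob al t' k'.+2
  end.

Variable al : R.
Hypothesis al01 : 0 < al < 1.

Lemma climb_prob_ge0 t k : 0 <= climb_prob al t k.
Proof.
elim: t k => [|t IH] [|k] //=.
by have := IH k; have := IH k.+2; move: al01; nra.
Qed.

Lemma climb_prob_le1 t k : climb_prob al t k <= 1.
Proof.
elim: t k => [|t IH] [|k] //=.
by have := IH k; have := IH k.+2; move: al01; nra.
Qed.

Lemma climb_prob_nd k : nondecreasing_seq (climb_prob al ^~ k).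
Proof.
apply/nondecreasing_seqP => t; elim: t k => [|t IH] [|k] //.
  by apply: climb_prob_ge0.
have := IH k; have := IH k.+2; move: al01 => /=.
set x1 := al * climb_prob al t k.
by move=> /andP[a0 a1] h2 h1; rewrite lerD // ler_pM2l // subr_gt0.
Qed.

(** Probability of ever climbing [k] levels when each step goes up with probability
[al]. *)
Definition reach_prob (k : nat) : R := limn (climb_prob al ^~ k).

Lemma cvg_climb_prob k : climb_prob al ^~ k @ \oo --> reach_prob k.
Proof.
apply: nondecreasing_is_cvgn; first exact: climb_prob_nd.
by exists 1 => _ [t _ <-]; exact: climb_prob_le1.
Qed.

Lemma reach_prob_ge0 k : 0 <= reach_prob k.
Proof.
apply: limr_ge; first by apply/cvg_ex; eexists; exact: cvg_climb_prob.
by near=> t; exact: climb_prob_ge0.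
Unshelve. all: by end_near. Qed.

Lemma reach_prob_le1 k : reach_prob k <= 1.
Proof.
apply: limr_le; first by apply/cvg_ex; eexists; exact: cvg_climb_prob.
by near=> t; exact: climb_prob_le1.
Unshelve. all: by end_near. Qed.

Lemma reach_prob0 : reach_prob 0 = 1.
Proof.
apply: cvg_lim => //; rewrite (_ : climb_prob al ^~ 0%N = cst 1); first exact: cvg_cst.
by apply/funext; case.
Qed.

(** Harmonicity, by conditioning on the first step. *)
Lemma reach_probS k :
  reach_prob k.+1 = al * reach_prob k + (1 - al) * reach_prob k.+2.
Proof.
apply: cvg_lim => //; rewrite -cvg_shiftS /=.
by apply: cvgD; apply: cvgMr; exact: cvg_climb_prob.
Qed.

Let rho := al / (1 - al).

(** The increments of a harmonic function of the walk form a geometric sequence. *)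
Lemma reach_prob_diff k :
  reach_prob k - reach_prob k.+1 = rho ^+ k * (1 - reach_prob 1).
Proof.
have a1 : 1 - al != 0 by rewrite gt_eqF // subr_gt0; case/andP: al01.
elim: k => [|k IH]; first by rewrite reach_prob0 expr0 mul1r.
have -> : reach_prob k.+2 = (reach_prob k.+1 - al * reach_prob k) / (1 - al).
  by rewrite (reach_probS k); field.
rewrite exprS -mulrA -IH /rho; by field.
Qed.

Lemma reach_prob_sum k :
  1 - reach_prob k = (\sum_(i < k) rho ^+ i) * (1 - reach_prob 1).
Proof.
elim: k => [|k IH]; first by rewrite big_ord0 reach_prob0 mul0r subrr.
rewrite big_ord_recr /= mulrDl -IH -reach_prob_diff; ring.
Qed.

(** The increments do not decrease here, so any positive first increment would make
their sums exceed 1. *)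
Lemma reach_prob_up : 2^-1 <= al -> forall k, reach_prob k = 1.
Proof.
move=> al2 k; have rho1 : 1 <= rho.
  by rewrite /rho ler_pdivlMr ?mul1r; [lra|rewrite subr_gt0; case/andP: al01].
suff w0 : 1 - reach_prob 1 = 0.
  by have := reach_prob_sum k; rewrite w0 mulr0; lra.
have wk n : n%:R * (1 - reach_prob 1) <= 1.
  rewrite (le_trans (y := 1 - reach_prob n)) //; last by have := reach_prob_ge0 n; lra.
  rewrite (reach_prob_sum n) ler_wpM2r //; first by have := reach_prob_le1 1; lra.
  rewrite -[X in X%:R]card_ord -sumr_const; apply: ler_sum => i _.
  exact: exprn_ege1.
have := reach_prob_le1 1; rewrite le_eqVlt => /orP[/eqP ->|lt1]; first exact: subrr.
have w0 : 0 < 1 - reach_prob 1 by lra.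
have := wk (Num.truncn (1 - reach_prob 1)^-1).+1.
have := truncnS_gt (1 - reach_prob 1)^-1.
by rewrite -(ltr_pM2l w0) divff ?gt_eqF // mulrC => h; rewrite leNgt h.
Qed.

(** The powers of [rho] are harmonic with value 1 at level 0; the finite-time
probabilities start below them and so stay below them. *)
Lemma climb_prob_le t k : al < 2^-1 -> climb_prob al t k <= rho ^+ k.
Proof.
move=> al2; have a1 : 0 < 1 - al by rewrite subr_gt0; case/andP: al01.
have rho0 : 0 <= rho by apply: divr_ge0; [case/andP: al01 => /ltW|exact: ltW].
elim: t k => [|t IH] [|k]; rewrite ?expr0 //=; first exact: exprn_ge0.
have -> : rho ^+ k.+1 = al * rho ^+ k + (1 - al) * rho ^+ k.+2.
  rewrite -[k.+2]addn2 -[k.+1]addn1 !exprD.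
  have -> : al * rho ^+ k = (1 - al) * rho * rho ^+ k.
    by congr (_ * _); rewrite /rho mulrCA divff ?mulr1 // gt_eqF.
  have -> : (1 - al) * (rho ^+ k * rho ^+ 2) = al * rho ^+ k * rho.
    have {2}-> : al = (1 - al) * rho by rewrite /rho mulrCA divff ?mulr1 // gt_eqF.
    by ring.
  by rewrite /rho; field; rewrite gt_eqF.
by case/andP: al01 => a0 _; rewrite lerD // ler_pM2l.
Qed.

(** By [reach_prob_sum] the first increment determines everything.  It is at
least [1 - rho] by [climb_prob_le], and at most [1 - rho] since the
probabilities are nonnegative at all levels. *)
Lemma reach_prob_down : al < 2^-1 -> forall k, reach_prob k = rho ^+ k.
Proof.
move=> al2 k; have a1 : 0 < 1 - al by rewrite subr_gt0; case/andP: al01.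
have rho0 : 0 <= rho by apply: divr_ge0; [case/andP: al01 => /ltW|exact: ltW].
have rho1 : rho < 1 by rewrite /rho ltr_pdivrMr // mul1r; lra.
have geo n : (1 - rho) * (1 - reach_prob n) = (1 - rho ^+ n) * (1 - reach_prob 1).
  by rewrite (reach_prob_sum n) mulrA; congr (_ * _); have := subrX1 rho n; lra.
have le1 : reach_prob 1 <= rho.
  apply: limr_le; first by apply/cvg_ex; eexists; exact: cvg_climb_prob.
  by near=> t; rewrite -[rho]expr1; exact: climb_prob_le.
have ge1 : 1 - reach_prob 1 <= 1 - rho.
  have cv : (1 - rho ^+ n) * (1 - reach_prob 1) @[n --> \oo] --> (1 - 0) * (1 - reach_prob 1).
    apply: cvgMl; apply: cvgB; first exact: cvg_cst.
    by apply: cvg_expr; rewrite ger0_norm.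
  rewrite -[leLHS]mul1r -[X in X * _]subr0 -(cvg_lim _ cv) //.
  apply: limr_le; first by apply/cvg_ex; eexists; exact: cv.
  near=> n; rewrite -geo -[leRHS]mulr1 ler_wpM2l //; first by lra.
  by have := reach_prob_ge0 n; lra.
have E : reach_prob 1 = rho by lra.
have := geo k; rewrite E mulrC => /mulIf; rewrite subr_eq0 gt_eqF // => /(_ isT).
lra.
Unshelve. all: by end_near. Qed.

End gambler.

(** * Events independent of a set of sources *)

Section independence.
Context (d : measure_display) (T : measurableType d) (R : realType)
  (P : probability T R).

Definition prob (A : set T) : R := fine (P A).

Lemma probE (A : set T) : measurable A -> P A = (prob A)%:E.
Proof. by move=> mA; rewrite /prob fineK //; exact: fin_num_measure. Qed.

Lemma prob_ge0 (A : set T) : 0 <= prob A.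
Proof. exact/fine_ge0/measure_ge0. Qed.

Lemma probT : prob setT = 1.
Proof. by rewrite /prob probability_setT. Qed.

Lemma prob0 : prob set0 = 0.
Proof. by rewrite /prob measure0. Qed.

Lemma prob_le (A B : set T) : measurable A -> measurable B -> A `<=` B ->
  prob A <= prob B.
Proof. by move=> mA mB AB; rewrite -lee_fin -!probE // le_measure // inE. Qed.

Lemma probU (A B : set T) : measurable A -> measurable B -> A `&` B = set0 ->
  prob (A `|` B) = prob A + prob B.
Proof.
move=> mA mB AB; apply: EFin_inj; rewrite EFinD -!probE //; last exact: measurableU.
exact: measureU.
Qed.

Lemma probD (A B : set T) : measurable A -> measurable B -> B `<=` A ->
  prob (A `\` B) = prob A - prob B.
Proof.
move=> mA mB BA; apply/eqP; rewrite eq_sym subr_eq; apply/eqP.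
rewrite -probU // ?setDKU //; first exact: measurableD.
by apply/seteqP; split=> w //= [[_ nB] /nB].
Qed.

Lemma cvg_prob (B : (set T)^nat) : (forall n, measurable (B n)) ->
  nondecreasing_seq B -> prob (B n) @[n --> \oo] --> prob (\bigcup_n B n).
Proof.
move=> mB ndB; apply: fine_cvg.
rewrite -probE; last exact: bigcup_measurable.
apply: nondecreasing_cvg_mu => //; exact: bigcup_measurable.
Qed.

Context (I : eqType) (F : I -> set (set T)).
Hypothesis F_measurable : forall e A, F e A -> measurable A.
Hypothesis F_independent : mutually_independent P F.

(** [indep_of S B] is preserved by intersections with events of a source in [S],
once that source is removed from [S] ([indep_of_setI]), and by disjoint unions,
proper differences and monotone limits.  This allows frogs to be revealed one
after the other, and avoids generated sigma-algebras. *)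
Definition indep_of (S : I -> Prop) (B : set T) : Prop :=
  measurable B /\ forall (s : seq I) (A : I -> set T), uniq s ->
    (forall e, e \in s -> S e /\ F e (A e)) ->
    prob (B `&` \big[setI/setT]_(e <- s) A e) =
    prob B * \prod_(e <- s) prob (A e).

Lemma indep_of_meas S B : indep_of S B -> measurable B.
Proof. by case. Qed.

Lemma measurable_bigI (s : seq I) (A : I -> set T) :
  (forall e, e \in s -> F e (A e)) -> measurable (\big[setI/setT]_(e <- s) A e).
Proof.
move=> FA; rewrite big_seq; apply: (big_ind (fun B => measurable B)) => //.
- by move=> *; exact: measurableI.
- by move=> e es; apply: F_measurable (FA e es).
Qed.

Lemma indep_ofT S : indep_of S setT.
Proof.
split=> // s A us FA; rewrite setTI probT mul1r; apply: EFin_inj.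
rewrite -probE; last by apply: measurable_bigI => e /FA[].
rewrite F_independent //; last by move=> e /FA[].
rewrite (@big_morph _ _ EFin 1%E *%E) //.
by apply: eq_big_seq => e /FA[_ /F_measurable]; exact: probE.
Qed.

Lemma indep_of_sub (S S' : I -> Prop) B :
  (forall e, S' e -> S e) -> indep_of S B -> indep_of S' B.
Proof.
move=> SS [mB H]; split=> // s A us FA; apply: H => // e es.
by have [? ?] := FA e es; split=> //; exact: SS.
Qed.

Lemma indep_of_setI (S : I -> Prop) B e A : indep_of S B -> S e -> F e A ->
  indep_of (fun e' => S e' /\ e' <> e) (B `&` A) /\ prob (B `&` A) = prob B * prob A.
Proof.
move=> [mB H] Se FA.
have E : prob (B `&` A) = prob B * prob A.
  have := H [:: e] (fun=> A) isT; rewrite !big_seq1; apply => e'.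
  by rewrite inE => /eqP ->.
split=> //; split; first by apply: measurableI => //; exact: F_measurable FA.
move=> s A' us FA'; rewrite -setIA E -mulrA.
have nes : e \notin s by apply/negP => /FA'[[_ /(_ erefl)]].
pose A2 e' := if e' == e then A else A' e'.
have -> : A `&` \big[setI/setT]_(e' <- s) A' e' =
          \big[setI/setT]_(e' <- e :: s) A2 e'.
  rewrite big_cons /A2 eqxx; congr (_ `&` _); apply: eq_big_seq => e' es.
  by case: eqP => // ee; move: nes; rewrite -ee es.
have -> : prob A * \prod_(e' <- s) prob (A' e') =
          \prod_(e' <- e :: s) prob (A2 e').
  rewrite big_cons /A2 eqxx; congr (_ * _); apply: eq_big_seq => e' es.
  by case: eqP => // ee; move: nes; rewrite -ee es.
apply: H => [|e']; first by rewrite /= nes.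
rewrite inE /A2 => /predU1P[->|es]; first by rewrite eqxx.
have [[S' ne] FA2] := FA' e' es.
by case: eqP => // ee; move: nes; rewrite -ee es.
Qed.

Lemma indep_of_setU S B1 B2 : indep_of S B1 -> indep_of S B2 -> B1 `&` B2 = set0 ->
  indep_of S (B1 `|` B2).
Proof.
move=> [m1 H1] [m2 H2] dj; split; first exact: measurableU.
move=> s A us FA; have mA : measurable (\big[setI/setT]_(e <- s) A e).
  by apply: measurable_bigI => e /FA[].
rewrite setIUl !probU // ?mulrDl ?H1 ?H2 //; try exact: measurableI.
by rewrite setIACA dj set0I.
Qed.

Lemma indep_of_setD S B1 B2 : indep_of S B1 -> indep_of S B2 -> B2 `<=` B1 ->
  indep_of S (B1 `\` B2).
Proof.
move=> [m1 H1] [m2 H2] sub; split; first exact: measurableD.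
move=> s A us FA; have mA : measurable (\big[setI/setT]_(e <- s) A e).
  by apply: measurable_bigI => e /FA[].
have -> : (B1 `\` B2) `&` \big[setI/setT]_(e <- s) A e =
   (B1 `&` \big[setI/setT]_(e <- s) A e) `\` (B2 `&` \big[setI/setT]_(e <- s) A e).
  by apply/seteqP; split=> w /=; tauto.
rewrite !probD // ?mulrBl ?H1 ?H2 //; try exact: measurableI.
exact: setSI.
Qed.

Lemma indep_of_set0 S : indep_of S set0.
Proof. by split=> // *; rewrite set0I prob0 mul0r. Qed.

Lemma indep_of_bigcup S (B : (set T)^nat) : (forall n, indep_of S (B n)) ->
  nondecreasing_seq B -> indep_of S (\bigcup_n B n).
Proof.
move=> uB ndB; have mB n : measurable (B n) by case: (uB n).
split; first exact: bigcup_measurable.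
move=> s A us FA; have mA : measurable (\big[setI/setT]_(e <- s) A e).
  by apply: measurable_bigI => e /FA[].
set C := \big[setI/setT]_(e <- s) A e in mA *.
have cvg1 : prob (B n `&` C) @[n --> \oo] --> prob ((\bigcup_n B n) `&` C).
  rewrite setI_bigcupl; apply: cvg_prob => [n|m n mn]; first exact: measurableI.
  by apply/subsetPset; apply: setSI; apply/subsetPset; exact: ndB.
have cvg2 : prob (B n `&` C) @[n --> \oo] -->
    prob (\bigcup_n B n) * \prod_(e <- s) prob (A e).
  under eq_cvg do rewrite (uB _).2 //.
  by apply: cvgMl; exact: cvg_prob.
exact: (cvg_unique _ cvg1 cvg2).
Qed.

Lemma indep_of_partition S (B : (set T)^nat) : (forall n, indep_of S (B n)) ->
  trivIset setT B -> indep_of S (\bigcup_n B n).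
Proof.
move=> uB tB; rewrite -bigcup_bigsetU_bigcup; apply: indep_of_bigcup; last first.
  by move=> m n mn; apply/subsetPset; exact: subset_bigsetU.
move=> n; elim: n.+1 => {n} [|n IH]; first by rewrite big_ord0; exact: indep_of_set0.
rewrite big_ord_recr /=; apply: indep_of_setU => //.
rewrite -bigcup_mkord; apply/seteqP; split=> // w [[i /= lt Bi] Bn].
have E : i = n by apply: tB => //; exists w.
by move: lt; rewrite E ltnn.
Qed.

Section walk.
Variables (e : nat -> I) (b : T -> nat -> bool) (al : R).
Hypothesis e_inj : injective e.
Hypothesis F_up : forall n, F (e n) [set w | b w n].
Hypothesis F_down : forall n, F (e n) [set w | ~~ b w n].
Hypothesis prob_up : forall n, prob [set w | b w n] = al.

(** Conditioning on step [s]: on each of its two outcomes, the sources of the later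
steps are still independent of the event at hand. *)
Lemma prob_climbs t s k S B : indep_of S B -> (forall n, (s <= n)%N -> S (e n)) ->
  let C := B `&` [set w | climbs (fun n => b w (s + n)%N) t k] in
  indep_of (fun e' => S e' /\ forall n, e' <> e n) C /\
  prob C = prob B * climb_prob al t k.
Proof.
have prob_down n : prob [set w | ~~ b w n] = 1 - al.
  rewrite -(prob_up n) -probT -probD //; last exact: F_measurable (F_up n).
  by congr prob; apply/seteqP; split=> w /=; [move/negP|case=> _ /negP].
elim: t s k S B => [|t IH] s [|k] S B uB Se C; rewrite {}/C.
- rewrite (_ : [set w | _] = setT); last by apply/seteqP; split.
  by rewrite setIT mulr1; split=> //; apply: indep_of_sub uB => ? [].
- rewrite (_ : [set w | _] = set0); last by apply/seteqP; split.
  by rewrite setI0 mulr0 prob0; split=> //; exact: indep_of_set0.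
- rewrite (_ : [set w | _] = setT); last by apply/seteqP; split.
  by rewrite setIT mulr1; split=> //; apply: indep_of_sub uB => ? [].
have [uU pU] := indep_of_setI uB (Se s (leqnn s)) (F_up s).
have [uD pD] := indep_of_setI uB (Se s (leqnn s)) (F_down s).
have Se' n : (s.+1 <= n)%N -> S (e n) /\ e n <> e s.
  by move=> sn; split; [apply: Se; exact: ltnW|move=> /e_inj E; move: sn; rewrite E ltnn].
have [uU' pU'] := IH s.+1 k _ _ uU Se'.
have [uD' pD'] := IH s.+1 k.+2 _ _ uD Se'.
set CU := (X in indep_of _ X) in uU' pU'.
set CD := (X in indep_of _ X) in uD' pD'.
have dj : CU `&` CD = set0.
  by apply/seteqP; split=> w //= [[[_ bw] _] [[_ /negP]]].
have -> : B `&` [set w | climbs (fun n => b w (s + n)%N) t.+1 k.+1] = CU `|` CD.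
  rewrite /CU /CD; apply/seteqP; split=> w /=; rewrite addn0.
    move=> [Bw]; rewrite (eq_climbs (g := fun n => b w (s.+1 + n)%N)) => [|n]; last first.
      by rewrite addSnnS.
    by case: (b w s) => Cw; [left|right].
  rewrite (eq_climbs (g := fun n => b w (s.+1 + n)%N)) => [|n]; last by rewrite addSnnS.
  by case=> -[[Bw]]; [move=> ->|move=> /negPf ->].
split.
  apply: indep_of_setU dj; [apply: indep_of_sub uU'|apply: indep_of_sub uD'] => e' [Se1 ne];
  by split=> //; split.
rewrite probU; [|exact: indep_of_meas uU'|exact: indep_of_meas uD'|by []].
by rewrite pU' pD' pU pD prob_up prob_down /=; ring.
Qed.

End walk.
End independence.

(** * Generating function of the number of frogs *)

Section nat_valued_mean.
Context (d : measure_display) (T : measurableType d) (R : realType)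
  (P : probability T R) (Y : {RV P >-> nat}).

Definition mass (x : nat) : R := prob P [set w | Y w = x].

Lemma mass_ge0 x : 0 <= mass x.
Proof. exact: prob_ge0. Qed.

Definition mean (h : nat -> R) : \bar R := (\sum_(x <oo) (mass x * h x)%:E)%E.

Lemma measurable_nat_preimage (A : set nat) : measurable [set w | A (Y w)].
Proof. by rewrite -[[set w | _]]setTI; exact: (measurable_funPT Y). Qed.

(** Expectations of functions of [Y] are series over its values. *)
Lemma meanE (h : nat -> R) : (forall x, 0 <= h x) ->
  (\int[P]_w (h (Y w))%:E)%E = mean h.
Proof.
move=> h0; have E : setT = \bigcup_x [set w | Y w = x].
  by apply/seteqP; split=> w // _; exists (Y w).
have mY x : measurable [set w | Y w = x] by exact: (measurable_nat_preimage [set x]).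
rewrite {1}E ge0_integral_bigcup //; first last.
- by move=> i j _ _ [w [/= <- <-]].
- by move=> w _; rewrite lee_fin.
- rewrite -E; apply/measurable_EFinP.
  have mh : measurable_fun [set: nat] h by [].
  exact: (measurableT_comp mh (measurable_funPT Y)).
apply: eq_eseriesr => x _.
transitivity (\int[P]_(w in [set w | Y w = x]) (cst (h x)%:E w))%E.
  by apply: eq_integral => w; rewrite inE /= => ->.
by rewrite integral_cst //= /mass EFinM muleC -probE.
Qed.

Lemma mean_le g h : (forall x, 0 <= g x) -> (forall x, mass x != 0 -> g x <= h x) ->
  (mean g <= mean h)%E.
Proof.
move=> g0 gh; apply: lee_nneseries => [x _ _|x _]; rewrite lee_fin.
  by rewrite mulr_ge0 ?mass_ge0.
case: (eqVneq (mass x) 0) => [->|m0]; first by rewrite !mul0r.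
by rewrite ler_wpM2l ?mass_ge0 // gh.
Qed.

Lemma eq_mean g h : (forall x, mass x != 0 -> g x = h x) -> mean g = mean h.
Proof.
move=> gh; apply: eq_eseriesr => x _.
by case: (eqVneq (mass x) 0) => [->|/gh ->] //; rewrite !mul0r.
Qed.

Lemma meanD g h : (forall x, 0 <= g x) -> (forall x, 0 <= h x) ->
  mean (g \+ h) = (mean g + mean h)%E.
Proof.
move=> g0 h0; rewrite /mean -nneseriesD => [|x _ _|x _ _]; first last.
- by rewrite lee_fin mulr_ge0 ?mass_ge0.
- by rewrite lee_fin mulr_ge0 ?mass_ge0.
by apply: eq_eseriesr => x _; rewrite /= mulrDr.
Qed.

Lemma meanZ c h : 0 <= c -> (forall x, 0 <= h x) ->
  mean (fun x => c * h x) = (c%:E * mean h)%E.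
Proof.
move=> c0 h0; rewrite /mean -nneseriesZl => [|x _]; last first.
  by rewrite lee_fin mulr_ge0 ?mass_ge0.
by apply: eq_eseriesr => x _; rewrite mulrCA.
Qed.

Lemma mean1 : mean (fun=> 1) = 1%E.
Proof.
rewrite -meanE; last by move=> _; exact: ler01.
by rewrite integral_cst //= probability_setT mule1.
Qed.

Lemma mean_ge0 h : (forall x, 0 <= h x) -> (0 <= mean h)%E.
Proof. by move=> h0; apply: nneseries_ge0 => x _ _; rewrite lee_fin mulr_ge0 ?mass_ge0. Qed.

Lemma mean_fin h : (forall x, 0 <= h x <= 1) -> mean h \is a fin_num.
Proof.
move=> h01; rewrite ge0_fin_numE; last by apply: mean_ge0 => x; case/andP: (h01 x).
apply: (@le_lt_trans _ _ 1%E); last exact: ltry.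
by rewrite -mean1; apply: mean_le => x; case/andP: (h01 x).
Qed.

Lemma mean_ge_mass h x : (forall x, 0 <= h x) -> ((mass x * h x)%:E <= mean h)%E.
Proof.
move=> h0; have := @nneseries_lim_ge _ (fun x => (mass x * h x)%:E) xpredT 0 x.+1.
rewrite sumEFin big_nat_recr //= => /(_ _)/(le_trans _); apply; last first.
  by move=> i _ _; rewrite lee_fin mulr_ge0 ?mass_ge0.
by rewrite lee_fin lerDr; apply: sumr_ge0 => i _; rewrite mulr_ge0 ?mass_ge0.
Qed.

Lemma pgf_mean (s : R) : 0 <= s -> pgf Y s = fine (mean (fun x => s ^+ x)).
Proof. by move=> s0; rewrite /pgf unlock meanE // => x; exact: exprn_ge0. Qed.

Lemma pow_mean_fin s n : 0 <= s <= 1 -> mean (fun x => s ^+ (x - n)) \is a fin_num.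
Proof.
move=> /andP[s0 s1]; apply: mean_fin => x.
by rewrite exprn_ge0 //= exprn_ile1.
Qed.

Section lowest_value.
Variable m : nat.
Hypothesis m_min : forall x, mass x != 0 -> (m <= x)%N.

(** The factor phi in f s = s^m phi s, where [m] is the least value of [Y]. *)
Definition reduced_pgf (s : R) : R := fine (mean (fun x => s ^+ (x - m))).

Lemma reduced_pgfK (s : R) : 0 <= s <= 1 ->
  (reduced_pgf s)%:E = mean (fun x => s ^+ (x - m)).
Proof. by move=> s01; rewrite fineK // pow_mean_fin. Qed.

Lemma pgf_reduced (s : R) : 0 <= s <= 1 -> pgf Y s = s ^+ m * reduced_pgf s.
Proof.
move=> s01; have /andP[s0 s1] := s01; rewrite pgf_mean // /reduced_pgf.
have -> : mean (fun x => s ^+ x) = ((s ^+ m)%:E * mean (fun x => (s ^+ (x - m))%R))%E.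
  rewrite -meanZ ?exprn_ge0 // => [|x]; last exact: exprn_ge0.
  by apply: eq_mean => x /m_min mx; rewrite -exprD subnKC.
by rewrite fineM // pow_mean_fin.
Qed.

Lemma reduced_pgf_mono (s t : R) : 0 <= s <= t -> t <= 1 ->
  reduced_pgf s <= reduced_pgf t.
Proof.
move=> /andP[s0 st] t1; have t0 := le_trans s0 st.
apply: fine_le; rewrite ?pow_mean_fin ?s0 ?t0 ?(le_trans st) //.
by apply: mean_le => x *; rewrite ?exprn_ge0 // lerXn2r ?nnegrE.
Qed.

Lemma reduced_pgf_ge (s : R) : 0 <= s <= 1 -> mass m <= reduced_pgf s.
Proof.
move=> s01; have /andP[s0 _] := s01.
have := @mean_ge_mass (fun x => s ^+ (x - m)) m.
rewrite subnn expr0 mulr1 => le.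
rewrite -lee_fin reduced_pgfK //.
by apply: le => x; exact: exprn_ge0.
Qed.

Lemma reduced_pgf_le1 (s : R) : 0 <= s <= 1 -> reduced_pgf s <= 1.
Proof.
move=> /andP[s0 s1]; rewrite -lee_fin reduced_pgfK ?s0 // -mean1.
by apply: mean_le => x *; rewrite ?exprn_ge0 // exprn_ile1.
Qed.

Lemma reduced_pgf1 : reduced_pgf 1 = 1.
Proof.
rewrite /reduced_pgf (_ : (fun x => 1 ^+ (x - m)) = fun=> 1) ?mean1 //.
by apply/funext => x; rewrite expr1n.
Qed.

(** Powers are convex, with slope at most [k] on the unit interval. *)
Lemma expr_lipschitz (s t : R) k : 0 <= s <= t -> t <= 1 ->
  t ^+ k <= s ^+ k + (t - s) * k%:R.
Proof.
move=> /andP[s0 st] t1; have t0 := le_trans s0 st; have s1 := le_trans st t1.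
elim: k => [|k IH]; first by rewrite !expr0 mulr0 addr0.
have sk : 0 <= s ^+ k <= 1 by rewrite exprn_ge0 //= exprn_ile1.
rewrite !exprS -natr1 mulrDr mulr1.
have : t * t ^+ k <= t * (s ^+ k + (t - s) * k%:R) by rewrite ler_wpM2l.
have : 0 <= (1 - t) * ((t - s) * k%:R) by rewrite !mulr_ge0 ?subr_ge0.
have : 0 <= (1 - s ^+ k) * (t - s) by rewrite mulr_ge0 ?subr_ge0 //; case/andP: sk.
lra.
Qed.

Lemma reduced_pgf_lipschitz (M s t : R) : (mean (fun x => x%:R%R) <= M%:E)%E ->
  0 <= s <= t -> t <= 1 -> reduced_pgf t - reduced_pgf s <= M * (t - s).
Proof.
move=> mM /andP[s0 st] t1; have t0 := le_trans s0 st; have s1 := le_trans st t1.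
rewrite lerBlDl -lee_fin EFinD EFinM !reduced_pgfK ?s0 ?t0 //.
apply: (@le_trans _ _ (mean ((fun x => s ^+ (x - m)) \+ (fun x => (t - s) * x%:R)))).
  apply: mean_le => x *; rewrite ?exprn_ge0 //=.
  have st0 : 0 <= s <= t by rewrite s0.
  apply: (le_trans (expr_lipschitz _ st0 t1)); rewrite lerD2l ler_wpM2l ?subr_ge0 //.
  by rewrite ler_nat leq_subr.
rewrite meanD => [|x|x]; rewrite ?exprn_ge0 ?mulr_ge0 ?subr_ge0 //.
rewrite leeD2l // meanZ ?subr_ge0 // muleC.
by apply: lee_wpmul2r => //; rewrite lee_fin subr_ge0.
Qed.

End lowest_value.

Lemma pgf_ge0 (s : R) : 0 <= s -> 0 <= pgf Y s.
Proof. by move=> s0; rewrite pgf_mean //; apply/fine_ge0/mean_ge0 => x; exact: exprn_ge0. Qed.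

Lemma pgf_mono (s t : R) : 0 <= s <= t -> t <= 1 -> pgf Y s <= pgf Y t.
Proof.
move=> /andP[s0 st] t1; have t0 := le_trans s0 st.
rewrite (@pgf_reduced 0) ?s0 ?(le_trans st) // (@pgf_reduced 0) ?t0 //.
by rewrite !expr0 !mul1r reduced_pgf_mono // s0.
Qed.

(** On the unit interval s^x is at most s unless x = 0. *)
Lemma pgf_lt1 (s : R) : 0 <= s < 1 -> mass 0 < 1 -> pgf Y s < 1.
Proof.
move=> /andP[s0 s1] m01; rewrite pgf_mean //.
have fin : mean (fun x => s ^+ x) \is a fin_num.
  by apply: mean_fin => x; rewrite exprn_ge0 // exprn_ile1 // ltW.
have fin0 : mean (fun x => (x == 0%N)%:R) \is a fin_num.
  by apply: mean_fin => x; case: eqP => _; rewrite ?lexx ler01.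
have -> : 1 = fine (mean (fun=> 1)) by rewrite mean1.
have le : (mean (fun x => (s ^+ x)%R) <=
   (1 - s)%:E * mean (fun x => ((x == 0%N)%:R)%R) + s%:E * mean (fun=> 1%R))%E.
  rewrite -!meanZ ?subr_ge0 ?(ltW s1) // -?meanD //; last first.
    by move=> x; rewrite mulr1.
    by move=> x; rewrite mulr_ge0 ?subr_ge0 ?(ltW s1).
  apply: mean_le => [x|x _]; first exact: exprn_ge0.
  rewrite /= mulr1.
  case: x => [|x]; first by rewrite expr0 mulr1 subrK.
  by rewrite mulr0 add0r exprS ler_piMr // exprn_ile1 // ltW.
have E0 : mean (fun x => (x == 0%N)%:R) = (mass 0)%:E.
  rewrite /mean (@nneseriesD1 _ _ 0%N) // ?mulr1 => [|k _]; last by rewrite lee_fin mulr_ge0 ?mass_ge0.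
  rewrite eseries0 ?adde0 // => i _ /negPf ->; by rewrite mulr0.
rewrite -lte_fin !fineK ?mean1 //; apply: (le_lt_trans le).
rewrite E0 mean1 mule1 -EFinM -EFinD lte_fin.
have : 0 < (1 - s) * (1 - mass 0) by rewrite mulr_gt0 ?subr_gt0.
lra.
Qed.

End nat_valued_mean.

(** * Probability that the frogs of one site miss a target *)

Section frog_events.
Context (d : measure_display) (T : measurableType d) (R : realType)
  (P : probability T R).
Variables (X : nat -> {RV P >-> nat})
  (left : nat -> nat -> nat -> {RV P >-> bool}) (p : nat -> R).
Hypothesis model : nonhomogeneous_frog_model X left p.

Local Notation F := (source_sigma X left).
Local Notation indep_of := (indep_of P F).
Local Notation prob := (prob P).

Lemma sigma_of_measurable d' (T' : measurableType d') (Y : {RV P >-> T'}) A :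
  sigma_of Y A -> measurable A.
Proof. by move=> [B mB <-]; apply: (measurable_funPT Y). Qed.

Lemma source_measurable e A : F e A -> measurable A.
Proof. by case: e => [j|[[j i] n]]; exact: sigma_of_measurable. Qed.

Lemma source_count j (B : set nat) : F (inl j) [set w | B (X j w)].
Proof. by exists B => //; rewrite setTI. Qed.

Lemma source_step j i n (B : set bool) : F (inr (j, i, n)) [set w | B (left j i n w)].
Proof. by exists B => //; rewrite setTI. Qed.

(** Frog [(j, i)] is displaced by [k] steps to the left if [c] holds, and to the
right otherwise, at some time of its own clock. *)
Definition frog_hits (c : bool) (j i k : nat) : set T :=
  [set w | exists t, climbs (fun n => left j i n w == c) t k].

Definition step_prob (c : bool) (j : nat) : R := if c then p j else 1 - p j.

Lemma p_gt j : 2^-1 < p j.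
Proof. by case/andP: (left_drift model j). Qed.

Lemma p_lt1 j : p j < 1.
Proof. by case/andP: (left_drift model j). Qed.

Lemma step_prob01 c j : 0 < step_prob c j < 1.
Proof. by have := p_gt j; have := p_lt1 j; rewrite /step_prob; case: c; lra. Qed.

Lemma prob_step c j i n : prob [set w | left j i n w == c] = step_prob c j.
Proof.
have mL := source_measurable (source_step j i n (fun b => b == true)).
have E : prob [set w | left j i n w == true] = p j.
  rewrite /prob -[RHS]/(fine (p j)%:E) -(left_prob model j i n).
  by congr (fine (P _)); apply/seteqP; split=> w /= /eqP.
case: c; first exact: E.
rewrite /step_prob -E -(probT P) -probD //.
by congr prob; apply/seteqP; split=> w /=; case: (left j i n w) => //= -[].
Qed.

Lemma prob_frog_hits c j i k S B : indep_of S B -> (forall n, S (inr (j, i, n))) ->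
  indep_of (fun e => S e /\ forall n, e <> inr (j, i, n)) (B `&` frog_hits c j i k) /\
  prob (B `&` frog_hits c j i k) = prob B * reach_prob (step_prob c j) k.
Proof.
move=> uB Se.
pose C t := B `&` [set w | climbs (fun n => left j i n w == c) t k].
have C_ok t := @prob_climbs _ _ _ _ _ _ source_measurable
  (fun n => inr (j, i, n) : source) (fun w n => left j i n w == c) (step_prob c j)
  (fun n m E => ltac:(by case: E)) (fun n => source_step j i n (fun b => b == c))
  (fun n => source_step j i n (fun b => b != c)) (prob_step c j i) t 0 k S B uB
  (fun n _ => Se n).
have ndC : nondecreasing_seq C.
  move=> s t st; apply/subsetPset => w [Bw Cw]; split=> //.
  exact: climbs_mono st Cw.
have E : B `&` frog_hits c j i k = \bigcup_t C t.
  apply/seteqP; split=> w /=; first by move=> [Bw [t Ct]]; exists t.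
  by move=> [t _ [Bw Ct]]; split=> //; exists t.
rewrite E; split.
  by apply: (indep_of_bigcup source_measurable _ ndC) => t; have [] := C_ok t.
have mC t : measurable (C t) by have [[]] := C_ok t.
apply/esym/(cvg_unique _ _ (cvg_prob mC ndC)) => //.
have -> : (fun t => prob (C t)) = fun t => prob B * climb_prob (step_prob c j) t k.
  by apply/funext => t; have [_] := C_ok t.
by apply: cvgMr; apply: cvg_climb_prob; exact: step_prob01.
Qed.

Definition step_ratio (j : nat) : R := (1 - p j) / p j.

Lemma step_ratio_gt0 j : 0 < step_ratio j.
Proof. by have := p_gt j; have := p_lt1 j => *; apply: divr_gt0; lra. Qed.

Lemma step_ratio_lt1 j : step_ratio j < 1.
Proof. by have := p_gt j => *; rewrite /step_ratio ltr_pdivrMr; lra. Qed.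

Lemma reach_right j k : reach_prob (step_prob false j) k = step_ratio j ^+ k.
Proof.
rewrite reach_prob_down; [|exact: step_prob01|by have := p_gt j; rewrite /step_prob; lra].
by rewrite /step_ratio /step_prob opprB addrCA subrr addr0.
Qed.

Lemma frog_hits_right j i k w : frog_hits false j i k w <->
  exists u, frog_walk (fun j i n => left j i n w) j i u = (j + k)%:Z.
Proof.
have E u : frog_walk (fun j i n => left j i n w) j i u =
  j%:Z + \sum_(m < u) (if left j i m w == false then 1 else -1).
  by rewrite /frog_walk; congr (_ + _); apply: eq_bigr => m _; case: (left j i m w).
split=> [[t /climbsP[u _ Eu]]|[u]]; first by exists u; rewrite E Eu PoszD.
by rewrite E PoszD => /addrI Eu; exists u; apply/climbsP; exists u.
Qed.

Lemma frog_hits_left j i w : frog_hits true j i j w <->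
  exists u, frog_walk (fun j i n => left j i n w) j i u = 0.
Proof.
have E u : frog_walk (fun j i n => left j i n w) j i u =
  j%:Z - \sum_(m < u) (if left j i m w == true then 1 else -1).
  rewrite /frog_walk -sumrN; congr (_ + _); apply: eq_bigr => m _.
  by case: (left j i m w).
split=> [[t /climbsP[u _ Eu]]|[u]]; first by exists u; rewrite E Eu subrr.
by rewrite E => /subr0_eq Eu; exists u; apply/climbsP; exists u.
Qed.

Definition missed (l m : nat) : set T :=
  [set w | ~ reaches (fun j => X j w) (fun j i n => left j i n w) l m].

(** The number of frogs that have to miss [m] is random, so its values are
separated. *)
Lemma missedE l m : (l <= m)%N -> missed l m =
  \bigcup_x ([set w | X l w = x] `&`
             [set w | forall i, (i < x)%N -> ~ frog_hits false l i (m - l) w]).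
Proof.
move=> lm; apply/seteqP; split=> w.
  move=> Mw; exists (X l w) => //; split=> // i ix /frog_hits_right.
  by rewrite subnKC // => Hi; apply: Mw; exists i.
move=> [x _ [/= <- Hx]] [i ix Hi]; apply: (Hx i ix).
by apply/frog_hits_right; rewrite subnKC.
Qed.

Lemma prob_all_miss l x k S B : indep_of S B -> (forall i n, S (inr (l, i, n))) ->
  let C := B `&` [set w | forall i, (i < x)%N -> ~ frog_hits false l i k w] in
  indep_of (fun e => S e /\ forall i n, (i < x)%N -> e <> inr (l, i, n)) C /\
  prob C = prob B * (1 - step_ratio l ^+ k) ^+ x.
Proof.
move=> uB Se; elim: x => [|x [uC pC]] /=.
  rewrite (_ : [set w | _] = setT); last by apply/seteqP; split.
  by rewrite setIT expr0 mulr1; split=> //; apply: indep_of_sub uB => e [].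
set C := (X in indep_of _ X) in uC pC *.
have Sx n : S (inr (l, x, n)) /\
    forall i m, (i < x)%N -> inr (l, x, n) <> inr (l, i, m) :> source.
  split=> // i m ix [xi _]; move: ix; by rewrite -xi ltnn.
have [uH pH] := prob_frog_hits false k uC Sx.
set H := (X in indep_of _ X) in uH pH.
rewrite (_ : B `&` _ = C `\` H); last first.
  rewrite /C /H; apply/seteqP; split=> w /=.
    move=> [Bw Hw]; split; first by split=> // i ix; apply: Hw; exact: ltnW.
    by move=> [_]; exact: Hw.
  move=> [[Bw Hw] nH]; split=> // i; rewrite ltnS leq_eqVlt => /predU1P[->|/Hw//] h.
  by apply: nH.
split.
  apply: (indep_of_setD source_measurable) => //; last by move=> w [].
    by apply: indep_of_sub uC => e [Se1 ne]; split=> // i n ix; apply: ne; exact: ltnW.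
  apply: indep_of_sub uH => e [Se1 ne]; split; last by move=> n; exact: ne.
  by split=> // i n ix; apply: ne; exact: ltnW.
rewrite probD; [|exact: indep_of_meas uC|exact: indep_of_meas uH|by move=> w []].
by rewrite pH pC reach_right exprS; ring.
Qed.

Definition ahead (l : nat) (e : source) : Prop :=
  match e with inl j => (l <= j)%N | inr (j, _, _) => (l <= j)%N end.

(** Each of the X_l frogs misses [m] with probability [1 - step_ratio l ^+ (m - l)],
independently; averaging over X_l gives the generating function. *)
Lemma prob_missed l m B : (l < m)%N -> indep_of (ahead l) B ->
  indep_of (ahead l.+1) (B `&` missed l m) /\
  prob (B `&` missed l m) = prob B * pgf (X l) (1 - step_ratio l ^+ (m - l)).
Proof.
move=> lm uB; rewrite (missedE (ltnW lm)) setI_bigcupr.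
set g := 1 - _; have g01 : 0 <= g <= 1.
  have r0 := step_ratio_gt0 l; have r1 := step_ratio_lt1 l.
  have h0 : 0 <= step_ratio l ^+ (m - l) by rewrite exprn_ge0 // ltW.
  have h1 : step_ratio l ^+ (m - l) <= 1 by rewrite exprn_ile1 // ltW.
  by rewrite /g; lra.
pose C x := B `&` ([set w | X l w = x] `&`
             [set w | forall i, (i < x)%N -> ~ frog_hits false l i (m - l) w]).
have C_ok x : indep_of (ahead l.+1) (C x) /\
    prob (C x) = prob B * (mass (X l) x * g ^+ x).
  have [//|uX pX] := indep_of_setI source_measurable uB _ (source_count l [set x]).
    exact: leqnn.
  have [|uC pC] := @prob_all_miss l x (m - l) _ _ uX.
    by move=> i n; split; [exact: leqnn|].
  rewrite /C setIA; split; last by rewrite pC pX mulrA.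
  apply: indep_of_sub uC => -[j|[[j i] n]] /= lj.
    by split=> //; split; [exact: ltnW|case=> jl; move: lj; rewrite jl ltnn].
  split; first by split=> //; exact: ltnW.
  by move=> i' n' _ [jl _ _]; move: lj; rewrite jl ltnn.
have tC : trivIset setT C by move=> x y _ _ [w [[_ [<- _]] [_ [<- _]]]].
have mC x : measurable (C x) by exact: indep_of_meas (C_ok x).1.
split; first by apply: (indep_of_partition source_measurable) => // x; have [] := C_ok x.
rewrite -[LHS]/(fine (P (\bigcup_x C x))) measure_semi_bigcup //; last exact: bigcup_measurable.
have -> : (\sum_(x <oo) P (C x) =
    \sum_(x <oo) ((prob B)%:E * (mass (X l) x * g ^+ x)%:E))%E.
  by apply: eq_eseriesr => x _; rewrite -EFinM -(C_ok x).2 probE.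
rewrite nneseriesZl => [|x _]; last first.
  by rewrite lee_fin mulr_ge0 ?mass_ge0 // exprn_ge0 //; case/andP: g01.
rewrite pgf_mean; last by case/andP: g01.
rewrite fineM // -/(mean (X l) (fun x => g ^+ x)); apply: mean_fin => x.
by case/andP: g01 => *; rewrite exprn_ge0 ?exprn_ile1.
Qed.

End frog_events.

(** * Renewal structure of the gaps *)

Section renewal.
Context (d : measure_display) (T : measurableType d) (R : realType)
  (P : probability T R).
Variables (X : nat -> {RV P >-> nat})
  (left : nat -> nat -> nat -> {RV P >-> bool}) (p : nat -> R).
Hypothesis model : nonhomogeneous_frog_model X left p.
Hypothesis identically_distributed :
  forall j, (1 <= j)%N -> distribution P (X j) = distribution P (X 1%N).

Local Notation F := (source_sigma X left).
Local Notation indep_of := (indep_of P F).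
Local Notation prob := (prob P).
Local Notation step_ratio := (step_ratio p).
Local Notation missed := (missed X left).

Let meas : forall e A, F e A -> measurable A := @source_measurable _ _ _ _ X left.

Lemma mass_iid j x : (1 <= j)%N -> mass (X j) x = mass (X 1) x.
Proof.
move=> j1.
exact: (congr1 (fun D : set nat -> \bar R => fine (D [set x])) (identically_distributed j1)).
Qed.

Lemma pgf_iid j (s : R) : (1 <= j)%N -> 0 <= s -> pgf (X j) s = pgf (X 1) s.
Proof.
move=> j1 s0; rewrite !pgf_mean //; congr fine.
by apply: eq_eseriesr => x _; rewrite mass_iid.
Qed.

Lemma pgf_origin (s : R) : 0 <= s -> pgf (X 0) s = s.
Proof.
move=> s0; rewrite /pgf (_ : (fun w => _) = cst s) ?expectation_cst //.
by apply/funext => w; rewrite (one_frog_at_origin model) expr1.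
Qed.

Lemma step_ratio_pow l k : 0 <= 1 - step_ratio l ^+ k <= 1.
Proof.
have r0 := step_ratio_gt0 model l; have r1 := step_ratio_lt1 model l.
have h0 : 0 <= step_ratio l ^+ k by rewrite exprn_ge0 // ltW.
have h1 : step_ratio l ^+ k <= 1 by rewrite exprn_ile1 // ltW.
by lra.
Qed.

(** Frogs from further right have less drift and reach further. *)
Lemma step_ratio_le j l : (1 <= j <= l)%N -> step_ratio j <= step_ratio l.
Proof.
move=> /andP[j1]; elim: l => [|l IH]; first by rewrite leqn0 => /eqP j0; move: j1; rewrite j0.
rewrite leq_eqVlt => /predU1P[->//|]; rewrite ltnS => jl.
apply: (le_trans (IH jl)).
have := drift_decreasing model (leq_trans j1 jl).
have := p_gt model l.+1; have := p_gt model l => a b c.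
rewrite /step_ratio ler_pdivrMr; last by lra.
by rewrite mulrAC ler_pdivlMr; nra.
Qed.

Definition gap (n m : nat) : set T :=
  [set w | unreached (fun j => X j w) (fun j i n => left j i n w) n m].

(** Probability that the frogs of the sites [n, ..., n + k - 1] all miss [n + k],
for [n >= 1]. *)
Definition gap_prob (n k : nat) : R :=
  \prod_(i < k) pgf (X 1) (1 - step_ratio (n + i) ^+ (k - i)).

Lemma gap_prob_ge0 n k : 0 <= gap_prob n k.
Proof. by apply: prodr_ge0 => i _; apply: pgf_ge0; case/andP: (step_ratio_pow (n + i) (k - i)). Qed.

(** Translation to the right increases every [step_ratio], so it lowers the
probability of a gap. *)
Lemma gap_prob_le n k : (1 <= n)%N -> gap_prob n k <= gap_prob 1 k.
Proof.
move=> n1; apply: ler_prod => i _; have r0 := step_ratio_gt0 model.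
have /andP[a0 a1] := step_ratio_pow (n + i) (k - i); have /andP[b0 b1] := step_ratio_pow (1 + i) (k - i).
rewrite pgf_ge0 //= pgf_mono // a0 /= lerD2l lerN2.
apply: lerXn2r; [by rewrite nnegrE ltW|by rewrite nnegrE ltW|].
by apply: step_ratio_le; rewrite add1n /= -add1n leq_add2r.
Qed.

Lemma prob_gap_gen n k B : indep_of (ahead n) B ->
  indep_of (ahead (n + k)) (B `&` gap n (n + k)) /\
  prob (B `&` gap n (n + k)) =
    prob B * \prod_(i < k) pgf (X (n + i)) (1 - step_ratio (n + i) ^+ (k - i)).
Proof.
move=> uB; pose C q := B `&` [set w | forall l, (n <= l < n + q)%N -> missed l (n + k)%N w].
suff H q : (q <= k)%N -> indep_of (ahead (n + q)) (C q) /\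
    prob (C q) = prob B * \prod_(i < q) pgf (X (n + i)) (1 - step_ratio (n + i) ^+ (k - i)).
  exact: H (leqnn k).
elim: q => [|q IH] qk.
  have -> : C 0%N = B.
    apply/seteqP; split=> w; first by case.
    move=> Bw; split=> // l /andP[nl]; by rewrite addn0 ltnNge nl.
  by rewrite addn0 big_ord0 mulr1.
have [uC pC] := IH (ltnW qk).
have lt : (n + q < n + k)%N by rewrite ltn_add2l.
have [uM pM] := prob_missed model lt uC.
have -> : C q.+1 = C q `&` missed (n + q) (n + k).
  apply/seteqP; split=> w.
    move=> [Bw Hw]; split; last by apply: Hw; rewrite leq_addr /= ltn_add2l.
    by split=> // l /andP[nl lq]; apply: Hw; rewrite nl (leq_trans lq) // leq_add2l.
  move=> [[Bw Hw] Mw]; split=> // l /andP[nl].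
  rewrite addnS ltnS leq_eqVlt => /predU1P[->//|lq]; apply: Hw; by rewrite nl.
by rewrite addnS pM pC big_ord_recr /= mulrA subnDl.
Qed.

Lemma prob_gap n k B : (1 <= n)%N -> indep_of (ahead n) B ->
  indep_of (ahead (n + k)) (B `&` gap n (n + k)) /\
  prob (B `&` gap n (n + k)) = prob B * gap_prob n k.
Proof.
move=> n1 /(prob_gap_gen k)[uG ->]; split=> //; congr (_ * _); apply: eq_bigr => i _.
by rewrite pgf_iid ?(leq_trans n1) ?leq_addr //; case/andP: (step_ratio_pow (n + i) (k - i)).
Qed.

Lemma prob_gap0 k : indep_of (ahead k.+1) (gap 0 k.+1) /\
  prob (gap 0 k.+1) = (1 - step_ratio 0 ^+ k.+1) * gap_prob 1 k.
Proof.
have [] := prob_gap_gen k.+1 (@indep_ofT _ _ _ _ _ _ meas (sources_independent model) (ahead 0)).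
rewrite setTI add0n => uG ->; split=> //; rewrite probT mul1r big_ord_recl /=.
rewrite add0n subn0 pgf_origin; last by case/andP: (step_ratio_pow 0 k.+1).
congr (_ * _); apply: eq_bigr => i _.
rewrite /bump /= add0n add1n subSS pgf_iid //.
by case/andP: (step_ratio_pow i.+1 (k - i)).
Qed.

(** First passage decomposition: a gap at [n] is preceded by a first gap at some
[m <= n], and given the latter it depends on the frogs from [m] on only. *)
Definition first_gap (n : nat) : set T :=
  gap 0 n `&` [set w | forall m, (0 < m < n)%N -> ~ gap 0 m w].

(** [gap m n] only involves frogs from [m] on, of which [first_gap m] is
independent. *)
Lemma prob_gap_after_first n q : (q < n)%N ->
  (forall m, (0 < m <= q)%N -> indep_of (ahead m) (first_gap m)) ->
  let C := [set w | exists2 m, (0 < m <= q)%N & (first_gap m `&` gap m n) w] in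
  indep_of (ahead n) C /\
  prob C = \sum_(m < q) prob (first_gap m.+1) * gap_prob m.+1 (n - m.+1).
Proof.
elim: q => [|q IH] qn uF /=.
  rewrite (_ : [set w | _] = set0); last first.
    by apply/seteqP; split=> w // [m /andP[m0]]; rewrite leqNgt m0.
  by rewrite big_ord0 prob0; split=> //; exact: indep_of_set0.
have [|uC pC] := IH (ltnW qn).
  by move=> m /andP[m0 mq]; apply: uF; rewrite m0 ltnW.
set C := [set w | _] in uC pC.
have [|uG pG] := @prob_gap q.+1 (n - q.+1) _ isT (uF q.+1 _); first exact/andP.
rewrite subnKC ?(ltnW qn) // in uG pG.
rewrite (_ : [set w | _] = C `|` (first_gap q.+1 `&` gap q.+1 n)); last first.
  apply/seteqP; split=> w.
    move=> [m /andP[m0]]; rewrite leq_eqVlt => /predU1P[->|mq] Fm; first by right.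
    by left; exists m => //; rewrite m0.
  move=> [[m /andP[m0 mq] Fm]|Fq]; first by exists m => //; rewrite m0 ltnW.
  by exists q.+1 => //; rewrite leqnn.
have dj : C `&` (first_gap q.+1 `&` gap q.+1 n) = set0.
  apply/seteqP; split=> w // [[m /andP[m0 mq] [[Gm _] _]] [[_ Hw] _]].
  by apply: (Hw m) => //; apply/andP; split.
split; first exact: (indep_of_setU meas).
rewrite probU; [|exact: indep_of_meas uC|exact: indep_of_meas uG|by []].
by rewrite pC pG big_ord_recr.
Qed.

Lemma gap_first n q w : (0 < n)%N ->
  (exists2 m, (0 < m <= q)%N & (first_gap m `&` gap m n) w) ->
  (q <= n)%N -> gap 0 n w.
Proof.
move=> n0 [m /andP[m0 mq] [[Gm _] Gmn]] qn.
by apply/(unreached_split (n := m)); rewrite ?(leq_trans mq).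
Qed.

Lemma exists_first_gap n w : (0 < n)%N -> gap 0 n w ->
  exists2 m, (0 < m <= n)%N & (first_gap m `&` gap m n) w.
Proof.
move=> n0 Gn; have ex : exists m, (0 < m <= n)%N && `[< gap 0 m w >].
  by exists n; rewrite n0 leqnn; apply/asboolP.
case: (ex_minnP ex) => m /andP[/andP[m0 mn] /asboolP Gm] min.
exists m; first by rewrite m0.
split; last by apply/(unreached_split (k := 0)).
split=> // k /andP[k0 km] Gk; move: (km); rewrite ltnNge => /negP; apply; apply: min.
by rewrite k0 (leq_trans (ltnW km)) //=; apply/asboolP.
Qed.

(** [first_gap n] is not an intersection of events of distinct sites, so its
independence of the frogs from [n] on is obtained by subtracting from [gap 0 n] the
disjoint events of an earlier first gap, by induction on [n]. *)
Lemma indep_of_first_gap n : (0 < n)%N -> indep_of (ahead n) (first_gap n).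
Proof.
elim/ltn_ind: n => -[//|n] IH _.
have [|uC _] := @prob_gap_after_first n.+1 n (ltnSn n).
  by move=> m /andP[m0 mn]; exact: IH.
set C := [set w | _] in uC.
have -> : first_gap n.+1 = gap 0 n.+1 `\` C.
  apply/seteqP; split=> w [Gn Hw]; split=> //.
    by move=> [m /andP[m0 mn] [[Gm _] _]]; apply: (Hw m) => //; rewrite m0.
  move=> m /andP[m0 mn] Gm; apply: Hw.
  have [k /andP[k0 km] [Fk Gkm]] := exists_first_gap m0 Gm.
  exists k; first by rewrite k0 (leq_trans km).
  split=> //; apply: (unreached_le (k := 0)) => //.
apply: (indep_of_setD meas) => //; first by have [] := prob_gap0 n.
by move=> w Cw; apply: (gap_first (q := n)).
Qed.

Lemma renewal_equation n : prob (gap 0 n.+1) =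
  \sum_(m < n.+1) prob (first_gap m.+1) * gap_prob m.+1 (n - m).
Proof.
have [|uC pC] := @prob_gap_after_first n.+2 n.+1 (ltnSn _).
  by move=> m /andP[m0 _]; exact: indep_of_first_gap.
have [|uD pD] := @prob_gap_after_first n.+1 n (ltnSn _).
  by move=> m /andP[m0 _]; exact: indep_of_first_gap.
set D := [set w | _] in uD pD.
have uF := @indep_of_first_gap n.+1 isT.
have -> : gap 0 n.+1 = D `|` first_gap n.+1.
  apply/seteqP; split=> w.
    move=> /(exists_first_gap (ltn0Sn n))[m /andP[m0]].
    rewrite leq_eqVlt => /predU1P[->|mn] Fm; first by right; case: Fm.
    by left; exists m => //; rewrite m0.
  by move=> [Dw|[]] //; apply: (gap_first (q := n)).
rewrite probU; [|exact: indep_of_meas uD|exact: indep_of_meas uF|]; last first.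
  apply/seteqP; split=> w // [[m /andP[m0 mq] [[Gm _] _]] [_ Hw]].
  by apply: (Hw m) => //; apply/andP; split.
by rewrite pD big_ord_recr /= subnn /gap_prob big_ord0 mulr1; congr (_ + _).
Qed.

Definition no_gap (n : nat) : set T :=
  [set w | forall m, (0 < m <= n)%N -> ~ gap 0 m w].

Definition never_gap : set T := [set w | forall m, (0 < m)%N -> ~ gap 0 m w].

Lemma prob_no_gap n : measurable (no_gap n) /\
  prob (no_gap n) = 1 - \sum_(m < n) prob (first_gap m.+1).
Proof.
elim: n => [|n [mE pE]].
  rewrite (_ : no_gap 0 = setT) ?probT ?big_ord0 ?subr0 //.
  by apply/seteqP; split=> w // _ m /andP[m0]; rewrite leqNgt m0.
have mF : measurable (first_gap n.+1) by exact: indep_of_meas (@indep_of_first_gap n.+1 isT).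
have -> : no_gap n.+1 = no_gap n `\` first_gap n.+1.
  apply/seteqP; split=> w.
    move=> Hw; split; first by move=> m /andP[m0 mn]; apply: Hw; rewrite m0 leqW.
    by case=> Gn _; apply: (Hw n.+1 _ Gn); rewrite /= leqnn.
  move=> [Hw nF] m /andP[m0]; rewrite leq_eqVlt => /predU1P[->|mn] Gm.
    by apply: nF; split=> // k /andP[k0 kn]; apply: Hw; rewrite k0.
  by apply: (Hw m) => //; rewrite m0.
split; first exact: measurableD.
rewrite probD //; last by move=> w [_ Hw] m /andP[m0 mn]; apply: Hw; rewrite m0.
by rewrite pE big_ord_recr /=; lra.
Qed.

Lemma measurable_never_gap : measurable never_gap.
Proof.
rewrite (_ : never_gap = \bigcap_n no_gap n).
  by apply: bigcapT_measurable => n; case: (prob_no_gap n).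
apply/seteqP; split=> w Hw; first by move=> n _ m /andP[m0 _]; exact: Hw.
by move=> m m0; apply: (Hw m I); rewrite m0 /=.
Qed.

Lemma sum_first_gap n : \sum_(m < n) prob (first_gap m.+1) <= 1 - prob never_gap.
Proof.
have [mE pE] := prob_no_gap n.
have : prob never_gap <= prob (no_gap n).
  apply: prob_le => //; first exact: measurable_never_gap.
  by move=> w Hw m /andP[m0 _]; exact: Hw.
by rewrite pE; lra.
Qed.

(** The renewal equation is a convolution; summing it over [n < M] bounds the left
side by the product of the two sums. *)
Lemma sum_prob_gap M : \sum_(n < M) prob (gap 0 n.+1) <=
  (1 - prob never_gap) * \sum_(k < M) gap_prob 1 k.
Proof.
(* Extended by 0, the convolution becomes a sum over a square, whose order can be
   exchanged. *)
pose t (m n : nat) : R :=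
  if (m <= n)%N then prob (first_gap m.+1) * gap_prob 1 (n - m) else 0.
have le1 (n : 'I_M) : prob (gap 0 n.+1) <= \sum_(m < M) t m n.
  rewrite renewal_equation (big_ord_widen M (fun m => prob (first_gap m.+1) * gap_prob m.+1 (n - m))) //.
  rewrite big_mkcond /=; apply: ler_sum => m _.
  by rewrite /t ltnS; case: ifP => // _; rewrite ler_wpM2l ?prob_ge0 // gap_prob_le.
have le2 (m : 'I_M) : \sum_(n < M) t m n <= prob (first_gap m.+1) * \sum_(k < M) gap_prob 1 k.
  rewrite mulr_sumr -(big_mkord xpredT (fun n => t m n)).
  rewrite (big_cat_nat (n := m)) //=; last exact: ltnW.
  rewrite big_nat big1 ?add0r => [|n /andP[_ nm]]; last by rewrite /t leqNgt nm.
  rewrite -{1}[m : nat]add0n big_addn big_mkord.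
  rewrite [leRHS](big_ord_widen_cond M xpredT (fun k => prob (first_gap m.+1) * gap_prob 1 k)) //.
  rewrite (big_ord_widen M (fun k => t m (k + m)%N)) ?leq_subr //.
  rewrite big_mkcond [leRHS]big_mkcond /=; apply: ler_sum => k _.
  rewrite /t leq_addl addnK; case: ifP => _; rewrite ?ltn_ord //.
  by rewrite mulr_ge0 ?prob_ge0 ?gap_prob_ge0.
apply: (le_trans (ler_sum _ (fun n _ => le1 n))); rewrite exchange_big /=.
apply: (le_trans (ler_sum _ (fun m _ => le2 m))); rewrite -mulr_suml.
apply: ler_wpM2r; last exact: sum_first_gap.
by apply: sumr_ge0 => k _; exact: gap_prob_ge0.
Qed.

Lemma gap_prob_le1 n k : gap_prob n k <= 1.
Proof.
apply: prodr_ile1 => i _; have /andP[a0 a1] := step_ratio_pow (n + i) (k - i).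
rewrite pgf_ge0 //= (@pgf_reduced _ _ _ _ _ 0) ?a0 // expr0 mul1r.
by apply: reduced_pgf_le1; rewrite a0.
Qed.

(** [P (gap 0 k.+1)] differs from [gap_prob 1 k] by the factor due to frog 0, which tends
to 1 geometrically fast.  Hence [sum_prob_gap] bounds the fraction [P never_gap] of
the series by a geometric series. *)
Lemma gap_sum_bounded M : 0 < prob never_gap ->
  \sum_(k < M) gap_prob 1 k <= (prob never_gap * (1 - step_ratio 0))^-1.
Proof.
move=> e0; have r0 := step_ratio_gt0 model 0; have r1 := step_ratio_lt1 model 0.
have := sum_prob_gap M.
under eq_bigr do rewrite (prob_gap0 _).2 mulrBl mul1r.
rewrite sumrB; set S := \sum_(k < M) _; set Q := \sum_(k < M) _ => le.
have leQ : Q <= (1 - step_ratio 0)^-1.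
  apply: (le_trans (y := \sum_(k < M) step_ratio 0 ^+ k)).
    apply: ler_sum => k _; rewrite exprS mulrAC -[leRHS]mul1r ler_wpM2r ?exprn_ge0 ?(ltW r0) //.
    by rewrite mulr_ile1 ?gap_prob_ge0 ?gap_prob_le1 ?(ltW r0) ?(ltW r1).
  have := subrX1 (step_ratio 0) M; set G := \sum_(k < M) _ => EG.
  rewrite -[leRHS]mul1r ler_pdivlMr ?subr_gt0 //.
  have : 0 <= step_ratio 0 ^+ M by rewrite exprn_ge0 // ltW.
  by lra.
rewrite invfM ler_pdivlMl //; lra.
Qed.

End renewal.

(** * Transience as divergence of the gap probabilities *)

Section transience.
Context (d : measure_display) (T : measurableType d) (R : realType)
  (P : probability T R).
Variables (X : nat -> {RV P >-> nat})
  (left : nat -> nat -> nat -> {RV P >-> bool}) (p : nat -> R).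
Hypothesis model : nonhomogeneous_frog_model X left p.
Hypothesis identically_distributed :
  forall j, (1 <= j)%N -> distribution P (X j) = distribution P (X 1%N).

Local Notation F := (source_sigma X left).
Local Notation indep_of := (indep_of P F).
Local Notation prob := (prob P).
Local Notation step_ratio := (step_ratio p).
Local Notation missed := (missed X left).
Local Notation gap := (gap X left).
Local Notation gap_prob := (gap_prob X p).
Local Notation never_gap := (never_gap X left).

Let meas : forall e A, F e A -> measurable A := @source_measurable _ _ _ _ X left.
Let indep_ofT S : indep_of S setT := @indep_ofT _ _ _ _ _ _ meas (sources_independent model) S.

Lemma prob_bigsetU_le (B : (set T)^nat) (b : nat -> R) :
  (forall n, measurable (B n)) -> (forall n, prob (B n) <= b n) ->
  forall M, prob (\big[setU/set0]_(n < M) B n) <= \sum_(n < M) b n.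
Proof.
move=> mB leB; elim=> [|M IH]; first by rewrite !big_ord0 prob0.
rewrite !big_ord_recr /=; set U := \big[setU/set0]_(n < M) B n in IH *.
have mU : measurable U by apply: bigsetU_measurable.
have -> : U `|` B M = U `|` (B M `\` U) by apply/seteqP; split=> w /=; have := EM (U w); tauto.
rewrite probU //; [|exact: measurableD|by apply/seteqP; split=> w //= [Uw []]].
apply: lerD => //; apply: le_trans (leB M).
by apply: prob_le => //; exact: measurableD.
Qed.

(** Frog 0 reaching site [N + 1] is independent of the other frogs, and makes gaps
possible only beyond [N + 1].  A gap at some [m] there requires the frogs from 1 to
[m - 1] to miss [m]; these probabilities add up to at most 1/2. *)
Lemma never_gap_pos C :
  (forall M, \sum_(k < M) gap_prob 1 k <= C) -> 0 < prob never_gap.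
Proof.
move=> bounded; pose S M := \sum_(k < M) gap_prob 1 k.
have g0 k : 0 <= gap_prob 1 k := gap_prob_ge0 model 1 k.
have ndS : nondecreasing_seq S.
  by apply/nondecreasing_seqP => M; rewrite /S big_ord_recr /= lerDl g0.
have cS : cvgn S by apply: nondecreasing_is_cvgn => //; exists C => _ [M _ <-]; exact: bounded.
have [N tailN] : exists N, forall M, \sum_(k < M) gap_prob 1 (N + k) <= 2^-1.
  have : \forall n \near \oo, limn S - 2^-1 < S n.
    by apply: (cvgr_gt _ cS); lra.
  case=> N _ /(_ N (leqnn N)) /= SN; exists N => M.
  have := nondecreasing_cvgn_le ndS cS (N + M)%N.
  have -> : S (N + M)%N = S N + \sum_(k < M) gap_prob 1 (N + k) by rewrite /S big_split_ord.
  lra.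
pose B0 := ~` missed 0 N.+1.
have r0 := step_ratio_gt0 model 0.
have [uM pM] := prob_missed model (ltn0Sn N) (indep_ofT (ahead 0)).
rewrite setTI in uM pM.
have uB : indep_of (ahead 1) B0 by rewrite /B0 -setTD; exact: (indep_of_setD meas).
have mB := indep_of_meas uB.
have pB : prob B0 = step_ratio 0 ^+ N.+1.
  rewrite /B0 -setTD probD //; last exact: indep_of_meas uM.
  rewrite pM probT subn0 (pgf_origin model) //; first by lra.
  by case/andP: (step_ratio_pow model 0 N.+1).
have pB0 : 0 < prob B0 by rewrite pB exprn_gt0.
pose G k := B0 `&` gap 1 (N + k).+1.
have G_ok k : measurable (G k) /\ prob (G k) = prob B0 * gap_prob 1 (N + k).
  have [uG pG] := prob_gap model identically_distributed (N + k) (leqnn 1) uB.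
  by rewrite -add1n; split; [exact: indep_of_meas uG|].
have mG k := (G_ok k).1.
have mU M : measurable (\big[setU/set0]_(k < M) G k) by exact: bigsetU_measurable.
have leU M : prob (\big[setU/set0]_(k < M) G k) <= prob B0 * 2^-1.
  apply: (le_trans (prob_bigsetU_le (b := fun k => prob B0 * gap_prob 1 (N + k)) mG _ M)).
    by move=> k; rewrite (G_ok k).2.
  by rewrite -mulr_sumr ler_wpM2l // prob_ge0.
have mUU : measurable (\bigcup_k G k) by exact: bigcup_measurable.
have leUU : prob (\bigcup_k G k) <= prob B0 * 2^-1.
  rewrite -bigcup_bigsetU_bigcup.
  have cv : prob (\big[setU/set0]_(i < k.+1) G i) @[k --> \oo] -->
      prob (\bigcup_k \big[setU/set0]_(i < k.+1) G i).
    apply: (cvg_prob (B := fun k => \big[setU/set0]_(i < k.+1) G i)) => //.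
    by move=> m n mn; apply/subsetPset; exact: subset_bigsetU.
  rewrite -(cvg_lim _ cv) //; apply: limr_le; first by apply/cvg_ex; eexists; exact: cv.
  by near=> k; exact: leU.
have sub : B0 `\` (\bigcup_k G k) `<=` never_gap.
  move=> w [Bw nG] m m0 Gm; case: (leqP m N.+1) => [mN|Nm].
    move: Bw => /contrapT r; apply: (Gm 0%N) => //; exact: reaches_le r.
  apply: nG; exists (m - N.+1)%N => //; split=> //.
  by rewrite -addSn subnKC ?(ltnW Nm) //; exact: unreached_le Gm.
have mD : measurable (B0 `\` \bigcup_k G k) by exact: measurableD.
have := @prob_le _ _ _ P _ _ mD (measurable_never_gap model identically_distributed) sub.
rewrite probD //; first by nra.
by move=> w [k _ []].
Unshelve. all: by end_near. Qed.

Lemma measurable_walk j i u z :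
  measurable [set w | frog_walk (fun j i n => left j i n w) j i u = z].
Proof.
elim: u z => [|u IH] z.
  case: (eqVneq (j%:Z) z) => [<-|ne].
    rewrite (_ : [set w | _] = setT) //; apply/seteqP; split=> w // _.
    by rewrite /= /frog_walk big_ord0 addr0.
  rewrite (_ : [set w | _] = set0) //; apply/seteqP; split=> w //=.
  by rewrite /frog_walk big_ord0 addr0 => E; move: ne; rewrite E eqxx.
rewrite (_ : [set w | _] =
    ([set w | left j i u w = true] `&`
      [set w | frog_walk (fun j i n => left j i n w) j i u = z + 1]) `|`
    ([set w | left j i u w = false] `&`
      [set w | frog_walk (fun j i n => left j i n w) j i u = z - 1])); last first.
  apply/seteqP; split=> w /=; rewrite frog_walkS; case: (left j i u w).
  - by move=> <-; left; split=> //; lia.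
  - by move=> <-; right; split=> //; lia.
  - by case=> -[] // _ ->; lia.
  - by case=> -[] // _ ->; lia.
by apply: measurableU; apply: measurableI => //;
  [exact: meas (source_step X left j i u (fun b => b = true))
  |exact: meas (source_step X left j i u (fun b => b = false))].
Qed.

Lemma measurable_count l i : measurable [set w | (i < X l w)%N].
Proof. exact: meas (source_count X left l (fun x => (i < x)%N)). Qed.

Local Notation age_at w t s := (age (fun j => X j w) (fun j i n => left j i n w) t s).

Lemma measurable_exists (I : countType) (A : I -> set T) :
  (forall i, measurable (A i)) -> measurable [set w | exists i, A i w].
Proof.
move=> mA; rewrite (_ : [set w | _] = \bigcup_n
    (if unpickle n is Some i then A i else set0)).
  by apply: bigcup_measurable => n _; case: unpickle.
apply/seteqP; split=> w /=; first by move=> [i Ai]; exists (pickle i) => //; rewrite pickleK.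
by move=> [n _]; case: unpickle => // i Ai; exists i.
Qed.

Lemma measurable_forall (I : countType) (A : I -> set T) :
  (forall i, measurable (A i)) -> measurable [set w | forall i, A i w].
Proof.
move=> mA; rewrite (_ : [set w | _] = ~` [set w | exists i, (~` A i) w]).
  by apply: measurableC; apply: measurable_exists => i; exact: measurableC.
by apply/seteqP; split=> w /=; [move=> Aw [i]; apply|move=> /forallNP Aw i; apply: contrapT].
Qed.

(** Ages take countably many values, and each step of the dynamics is a countable
combination of the preceding ages and of the walks. *)
Lemma measurable_age t j o : measurable [set w | age_at w t j = o].
Proof.
suff Some_ok k : measurable [set w | age_at w t j = Some k].
  case: o => // ; rewrite (_ : [set w | _] = ~` [set w | exists k, age_at w t j = Some k]).
    by apply: measurableC; exact: measurable_exists.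
  apply/seteqP; split=> w /=; first by move=> -> [].
  by case: (age_at w t j) => // k H; case: H; exists k.
elim: t j k => [|t IH] j k.
  have [h|h] := EM ((if j == 0%N then Some 0%N else None) = Some k).
    by rewrite (_ : [set w | _] = setT) //; apply/seteqP; split.
  by rewrite (_ : [set w | _] = set0) //; apply/seteqP; split.
pose woken := [set w | exists lik : nat * nat * nat,
  ((lik.1.2 < X lik.1.1 w)%N /\ age_at w t lik.1.1 = Some lik.2) /\
  frog_walk (fun j i n => left j i n w) lik.1.1 lik.1.2 lik.2.+1 = j%:Z].
have mW : measurable woken.
  apply: measurable_exists => -[[l i] q] /=.
  by apply: measurableI; [apply: measurableI|]; [exact: measurable_count|exact: IH|exact: measurable_walk].
have wokenE w : woken w <-> exists l i q, [/\ (i < X l w)%N, age_at w t l = Some q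
   & frog_walk (fun j i n => left j i n w) l i q.+1 = j%:Z].
  split; first by move=> [[[l i] q] /= [[? ?] ?]]; exists l, i, q.
  by move=> [l [i [q [? ? ?]]]]; exists (l, i, q).
have mS : measurable [set w | exists q, age_at w t j = Some q].
  by apply: measurable_exists => q; exact: IH.
case: k => [|k].
  rewrite (_ : [set w | _] = woken `\` [set w | exists q, age_at w t j = Some q]).
    exact: measurableD.
  apply/seteqP; split=> w /=.
    case E: (age_at w t j) => [q|] //; case: asboolP => // /wokenE W _.
    by split=> // -[].
  move=> [W nS]; case E: (age_at w t j) => [q|]; first by case: nS; exists q.
  by case: asboolP => // -[]; apply/wokenE.
rewrite (_ : [set w | _] = [set w | age_at w t j = Some k]) //.
apply/seteqP; split=> w /=; last by move=> ->.
case E: (age_at w t j) => [q|] //; last by case: asboolP.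
by case=> ->.
Qed.

Lemma measurable_infinite_hits : measurable (infinitely_many_hit_origin X left).
Proof.
rewrite (_ : infinitely_many_hit_origin X left = [set w | forall s : seq (nat * nat),
    exists f : nat * nat,
      hits_origin (fun j => X j w) (fun j i n => left j i n w) f /\ f \notin s]); last first.
  apply/seteqP; split=> w.
    by move=> /infinite_setP_seq H s; have [f Hf fs] := H s; exists f.
  by move=> H; apply/infinite_setP_seq => s; have [f [Hf fs]] := H s; exists f.
apply: measurable_forall => s.
apply: measurable_exists => -[j i].
case: (boolP ((j, i) \in s)) => ns.
  by rewrite [X in measurable X](_ : _ = set0) //; apply/seteqP; split=> w // [_ /negP].
rewrite [X in measurable X](_ : _ = [set w | (i < X j w)%N] `&`
  [set w | exists tk : nat * nat, age_at w tk.1 j = Some tk.2 /\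
     frog_walk (fun j i n => left j i n w) j i tk.2 = 0]).
  apply: measurableI; first exact: measurable_count.
  apply: measurable_exists => -[t k] /=.
  by apply: measurableI; [exact: measurable_age|exact: measurable_walk].
apply/seteqP; split=> w.
  by move=> [[/= ix [t [k [E W]]]] _]; split=> //; exists (t, k).
by move=> [/= ix [[t k] [E W]]]; split=> //; split=> //; exists t, k.
Qed.

Lemma prob_null_bigcup (B : (set T)^nat) : (forall n, measurable (B n)) ->
  (forall n, prob (B n) = 0) -> prob (\bigcup_n B n) = 0.
Proof.
move=> mB B0; apply/eqP; rewrite eq_le prob_ge0 andbT.
rewrite -bigcup_bigsetU_bigcup.
have cv : prob (\big[setU/set0]_(i < k.+1) B i) @[k --> \oo] -->
    prob (\bigcup_k \big[setU/set0]_(i < k.+1) B i).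
  apply: (cvg_prob (B := fun k => \big[setU/set0]_(i < k.+1) B i)) => [k|m n mn].
    exact: bigsetU_measurable.
  by apply/subsetPset; exact: subset_bigsetU.
rewrite -(cvg_lim _ cv) //; apply: limr_le; first by apply/cvg_ex; eexists; exact: cv.
near=> k; apply: (le_trans (prob_bigsetU_le (b := fun=> 0) mB _ k.+1)).
  by move=> n; rewrite B0.
by rewrite big1.
Unshelve. all: by end_near. Qed.

Lemma frog_returns j i : measurable (~` frog_hits left true j i j) /\
  prob (~` frog_hits left true j i j) = 0.
Proof.
have [//|uH pH] := prob_frog_hits model true j (indep_ofT (fun _ => True)) (i := i) (j := j).
rewrite setTI in uH pH; have mH := indep_of_meas uH.
split; first exact: measurableC.
rewrite -setTD probD // pH probT mul1r reach_prob_up ?subrr //.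
  exact: (step_prob01 model).
by rewrite ltW //; exact: (p_gt model j).
Qed.

Lemma mass0_lt1 : mass (X 1) 0 < 1.
Proof.
have mX : measurable [set w | (1 <= X 1 w)%N] by exact: measurable_count.
have m0 : measurable [set w | X 1 w = 0%N] := measurable_nat_preimage (X 1) [set 0%N].
have E : setT `\` [set w | X 1 w = 0%N] = [set w | (1 <= X 1 w)%N].
  apply/seteqP; split=> w /=; rewrite lt0n; first by move=> [_ /eqP].
  by move=> /eqP.
have pos : 0 < prob [set w | (1 <= X 1 w)%N].
  by have := frogs_possible model (leqnn 1); rewrite probE // lte_fin.
have := probD P measurableT m0 (@subsetT _ _).
by rewrite E probT /mass => h; lra.
Qed.

(** Infinitely many sites carry a frog, since each does so independently with the
same positive probability. *)
Lemma prob_all_empty n : let E := [set w | forall j, (n <= j)%N -> X j w = 0%N] in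
  measurable E /\ prob E = 0.
Proof.
move=> E; have m01 := mass0_lt1.
pose C k := [set w | forall q, (q < k)%N -> X (n.+1 + q) w = 0%N].
have C_ok k : indep_of (ahead (n.+1 + k)) (C k) /\ prob (C k) = mass (X 1) 0 ^+ k.
  elim: k => [|k [uC pC]].
    rewrite (_ : C 0%N = setT) ?probT //; by apply/seteqP; split.
  have [|uD pD] := indep_of_setI meas uC _ (source_count X left (n.+1 + k) [set 0%N]).
    exact: leqnn.
  rewrite (_ : C k.+1 = C k `&` [set w | [set 0%N] (X (n.+1 + k) w)]); last first.
    apply/seteqP; split=> w.
      by move=> Cw; split; [move=> q qk; apply: Cw; exact: leqW|exact: Cw].
    by move=> [Cw Xk] q; rewrite ltnS leq_eqVlt => /predU1P[->|/Cw].
  split; last first.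
    rewrite pD pC exprSr; congr (_ * _); exact: (mass_iid identically_distributed 0).
  apply: indep_of_sub uD => -[j|[[j i] m]] /=; rewrite addnS => lt; split=> //.
  - exact: ltnW.
  - by case=> E'; move: lt; rewrite E' ltnn.
  - exact: ltnW.
have mC k : measurable (C k) := indep_of_meas (C_ok k).1.
have mE : measurable E.
  rewrite (_ : E = \bigcap_j [set w | (n <= j)%N -> X j w = 0%N]).
    apply: bigcapT_measurable => j.
    exact: meas (source_count X left j (fun x => (n <= j)%N -> x = 0%N)).
  by apply/seteqP; split=> w Ew j; [move=> _; exact: Ew|exact: (Ew j I)].
split=> //; apply/eqP; rewrite eq_le prob_ge0 andbT.
have cv : mass (X 1) 0 ^+ k @[k --> \oo] --> (0 : R).
  by apply: cvg_expr; rewrite ger0_norm ?mass_ge0.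
rewrite -(cvg_lim _ cv) //; apply: limr_ge; first by apply/cvg_ex; eexists; exact: cv.
near=> k; rewrite -(C_ok k).2; apply: prob_le => // w Ew q _; apply: Ew.
by rewrite (leq_trans (leqnSn n)) // leq_addr.
Unshelve. all: by end_near. Qed.

(** The two events differ by null sets: a frog that never returns to the origin, or
a half-line without frogs. *)
Lemma transient_never_gap : transient X left <-> prob never_gap = 0.
Proof.
have mI := measurable_infinite_hits.
have mN : measurable never_gap := measurable_never_gap model identically_distributed.
have I_sub : infinitely_many_hit_origin X left `<=` never_gap.
  by move=> w Hw m m0; exact: (infinite_hits_reached Hw m0).
pose N1 := \bigcup_j \bigcup_i ~` frog_hits left true j i j.
pose N2 := \bigcup_n [set w | forall j, (n <= j)%N -> X j w = 0%N].
have mret j : measurable (\bigcup_i ~` frog_hits left true j i j).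
  by apply: bigcup_measurable => i _; case: (frog_returns j i).
have mN1 : measurable N1 by apply: bigcup_measurable => j _.
have mN2 : measurable N2 by apply: bigcup_measurable => n _; case: (prob_all_empty n).
have N1_0 : prob N1 = 0.
  apply: prob_null_bigcup => // j; apply: prob_null_bigcup => i; by case: (frog_returns j i).
have N2_0 : prob N2 = 0.
  by apply: prob_null_bigcup => n; case: (prob_all_empty n).
have sub_N : never_gap `<=` infinitely_many_hit_origin X left `|` (N1 `|` N2).
  move=> w Nw; apply: contrapT => /not_orP[nI /not_orP[n1 n2]]; apply: nI.
  apply: reached_infinite_hits => [m m0|j i|n]; first exact: Nw.
    apply/frog_hits_left; apply: contrapT => h; apply: n1.
    by exists j => //; exists i.
  apply: contrapT => h; apply: n2; exists n => // j nj.
  apply/eqP; rewrite -leqn0 leqNgt; apply/negP => xj; apply: h.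
  by exists j.
have mNN : measurable (N1 `|` N2) by exact: measurableU.
have le : prob never_gap <= prob (infinitely_many_hit_origin X left).
  apply: (le_trans (prob_le P mN (measurableU _ _ mI mNN) sub_N)).
  have := prob_bigsetU_le (B := fun n => nth set0 [:: infinitely_many_hit_origin X left; N1; N2] n)
    (b := fun n => prob (nth set0 [:: infinitely_many_hit_origin X left; N1; N2] n)).
  move=> /(_ _ (fun=> lexx _) 3); rewrite !big_ord_recr !big_ord0 /= set0U add0r.
  rewrite N1_0 N2_0 !addr0 setUA; apply=> -[|[|[|n]]] //=.
  by rewrite nth_nil.
have ge : prob (infinitely_many_hit_origin X left) <= prob never_gap by exact: prob_le.
rewrite /transient probE //; split=> [[E]|E].
  by apply/eqP; rewrite eq_le prob_ge0 andbT (le_trans le) ?E.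
by congr (_%:E); apply/eqP; rewrite eq_le prob_ge0 andbT -E.
Qed.

Theorem transient_iff_gap_sum : transient X left <->
  ~ exists C, forall M, \sum_(k < M) gap_prob 1 k <= C.
Proof.
rewrite transient_never_gap; split=> [E [C /never_gap_pos]|H]; first by rewrite E ltxx.
apply/eqP; rewrite eq_le prob_ge0 andbT leNgt; apply/negP => pos; apply: H.
by eexists => M; exact: (gap_sum_bounded model identically_distributed M pos).
Qed.

End transience.

(** * Areas under nonincreasing and convex functions *)

Section area.
Context {R : realType}.
Local Notation mu := (@lebesgue_measure R).

Lemma integral_affine (al be a b : R) : a < b ->
  (\int[mu]_(x in `]a, b]) (al + be * x)%:E = ((b - a) * (al + be * ((a + b) / 2)))%:E)%E.
Proof.
move=> ab; have cont : continuous (fun x : R => al + be * x).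
  by move=> x; apply: cvgD; [exact: cvg_cst|apply: cvgMr; exact: cvg_id].
rewrite integral_itv_obnd_cbnd; last first.
  apply/measurable_EFinP; apply: measurable_funTS; exact: continuous_measurable_fun.
pose G x : R := al * x + be / 2 * x ^+ 2.
have dG (x : R) : is_derive x (1 : R) G (al + be * x).
  rewrite /G; apply: is_derive_eq.
  by rewrite /GRing.scale /=; field.
rewrite (@continuous_FTC2 _ _ G) //.
- by rewrite -EFinB /G; congr (_%:E); field.
- by apply: continuous_subspaceT => x; exact: cont.
- have cG : continuous G.
    move=> x; apply: differentiable_continuous; apply/derivable1_diffP; exact: ex_derive.
  split; first by move=> x _; exact: ex_derive.
  - exact: cvg_at_right_filter (cG a).
  - exact: cvg_at_left_filter (cG b).
- by move=> x _; rewrite derive1E; exact: derive_val.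
Qed.

Variable f : R -> R.
Hypothesis f_ge0 : forall x : R, 0 < x -> 0 <= f x.
Hypothesis f_ni : forall x y : R, 0 < x -> x <= y -> f y <= f x.

(** The preimages of the half-lines [r, oo) are intervals. *)
Lemma measurable_decreasing : measurable_fun (`]0, +oo[%classic : set R) (EFin \o f).
Proof.
apply/measurable_EFinP.
apply: (measurability (@RGenCInfty.G R)) => [|/= _ [_] [r] -> <-].
  exact: RGenCInfty.measurableE.
apply: is_interval_measurable => s t/=.
rewrite !in_itv/= !andbT => -[s0 fs] [t0 ft] u /andP[su ut].
rewrite in_itv /= !andbT in fs ft *; split; first exact: lt_le_trans su.
by rewrite in_itv /= andbT (le_trans ft) // f_ni // (lt_le_trans s0).
Qed.

Definition area (a b : R) : \bar R := (\int[mu]_(x in `]a, b]) (f x)%:E)%E.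
Definition area_oo (a : R) : \bar R := (\int[mu]_(x in `]a, +oo[) (f x)%:E)%E.

Lemma measurable_decreasing_itv (a : R) (i : itv_bound R) : 0 <= a ->
  measurable_fun ([set` Interval (BRight a) i] : set R) (EFin \o f).
Proof.
move=> a0; apply: (measurable_funS _ _ measurable_decreasing) => //.
by move=> x /=; rewrite !in_itv /= andbT => /andP[ax _]; exact: le_lt_trans ax.
Qed.

Lemma area_ge0 (a b : R) : 0 <= a -> (0 <= area a b)%E.
Proof.
move=> a0; apply: integral_ge0 => x /=; rewrite in_itv /= => /andP[ax _].
by rewrite lee_fin f_ge0 // (le_lt_trans a0).
Qed.

Lemma area_oo_ge0 (a : R) : 0 <= a -> (0 <= area_oo a)%E.
Proof.
move=> a0; apply: integral_ge0 => x /=; rewrite in_itv /= => /andP[ax _].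
by rewrite lee_fin f_ge0 // (le_lt_trans a0).
Qed.

Lemma area_split_gen (a b : R) i : 0 <= a -> a <= b -> (BRight b <= i)%O ->
  (\int[mu]_(x in [set` Interval (BRight a) i]) (f x)%:E =
   area a b + \int[mu]_(x in [set` Interval (BRight b) i]) (f x)%:E)%E.
Proof.
move=> a0 ab bi.
have E : [set` Interval (BRight a) i] =
    `]a, b]%classic `|` [set` Interval (BRight b) i].
  by apply/seteqP; rewrite -itv_bndbnd_setU //=; split.
rewrite {1}E ge0_integral_setU //.
- by rewrite -E; exact: measurable_decreasing_itv.
- rewrite -E => x /=; rewrite itv_boundlr => /andP[ax _].
  by rewrite lee_fin f_ge0 // (le_lt_trans a0) // -bnd_simp.
- apply/disj_setPRL => x /=; rewrite itv_boundlr => /andP[bx _]; rewrite in_itv /=.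
  move=> /andP[_ xb]; move: bx; rewrite bnd_simp; by rewrite ltNge xb.
Qed.

Lemma area_split (a b c : R) : 0 <= a -> a <= b -> b <= c ->
  area a c = (area a b + area b c)%E.
Proof. by move=> a0 ab bc; apply: area_split_gen; rewrite ?bnd_simp. Qed.

Lemma area_oo_split (a b : R) : 0 <= a -> a <= b ->
  area_oo a = (area a b + area_oo b)%E.
Proof. by move=> a0 ab; apply: area_split_gen. Qed.

Lemma integral_const (a b k : R) : a <= b ->
  (\int[mu]_(x in `]a, b]) k%:E = ((b - a) * k)%:E)%E.
Proof.
move=> ab; rewrite integral_cst //= lebesgue_measure_itv /= lte_fin.
case: ltP => [_|ba]; first by rewrite -EFinD -EFinM mulrC.
have -> : b = a by apply/eqP; rewrite eq_le ba ab.
by rewrite subrr mul0r mule0.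
Qed.

Lemma area_ge (a b : R) : 0 <= a -> a <= b -> (((b - a) * f b)%:E <= area a b)%E.
Proof.
move=> a0 ab; rewrite -integral_const //.
case: (eqVneq a b) => [<-|ne].
  by rewrite /area (_ : `]a, a]%classic = set0) ?integral_set0 // set_itvE.
have b0 : 0 < b by rewrite (le_lt_trans a0) // lt_neqAle ne.
apply: ge0_le_integral => //.
- by move=> x _; rewrite lee_fin f_ge0.
- exact: measurable_decreasing_itv.
- move=> x /=; rewrite in_itv /= => /andP[ax xb].
  by rewrite lee_fin f_ni // (le_lt_trans a0).
Qed.

Lemma area_le (a b : R) : 0 < a -> a <= b -> (area a b <= ((b - a) * f a)%:E)%E.
Proof.
move=> a0 ab; rewrite -integral_const //; apply: ge0_le_integral => //.
- move=> x /=; rewrite in_itv /= => /andP[ax xb].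
  by rewrite lee_fin f_ge0 // (lt_trans a0).
- by apply: measurable_decreasing_itv; exact: ltW.
- move=> x /=; rewrite in_itv /= => /andP[ax xb].
  by rewrite lee_fin f_ni // ltW.
Qed.

Lemma area_le_oo (a b : R) : 0 <= a -> a <= b -> (area a b <= area_oo a)%E.
Proof. by move=> a0 ab; rewrite (area_oo_split a0 ab) leeDl // area_oo_ge0 // (le_trans a0). Qed.

Section convex.
Variable slope : R -> R.
Hypothesis f_tangent : forall c x : R, 0 < c -> 0 < x -> f c - slope c * (x - c) <= f x.

(** The function lies above its supporting line at the midpoint [c]. *)
Lemma area_midpoint (c h : R) : 0 < h -> h < c -> ((2 * h * f c)%:E <= area (c - h) (c + h))%E.
Proof.
move=> h0 hc; have lt : c - h < c + h by lra.
have -> : (2 * h * f c)%:E =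
   (\int[mu]_(x in `](c - h)%R, (c + h)%R]) ((f c + slope c * c)%R + (- slope c)%R * x)%R%:E)%E.
  by rewrite integral_affine //; congr (_%:E); field.
have fin : (mu `](c - h)%R, (c + h)%R]%classic < +oo)%E.
  by rewrite lebesgue_measure_itv /= lte_fin lt -EFinB ltry.
have pos : 0 < c - h by lra.
apply: le_integral => //.
- apply: measurable_bounded_integrable => //.
    by apply: measurable_funTS; apply: continuous_measurable_fun => x;
      apply: cvgD; [exact: cvg_cst|apply: cvgMr; exact: cvg_id].
  exists (`|f c + slope c * c| + `|slope c| * (c + h)); split; first exact: num_real.
  move=> M ltM x /=; rewrite in_itv /= => /andP[x1 x2].
  apply: (le_trans (ler_normD _ _)); apply/ltW/(le_lt_trans _ ltM).
  rewrite lerD2l normrM normrN ler_wpM2l // gtr0_norm //; exact: lt_trans x1.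
- apply: measurable_bounded_integrable => //.
    by apply/measurable_EFinP; apply: measurable_decreasing_itv; exact: ltW.
  exists (f (c - h)); split; first exact: num_real.
  move=> M ltM x /=; rewrite in_itv /= => /andP[x1 x2].
  have x0 : 0 < x by exact: lt_trans x1.
  by rewrite ger0_norm ?f_ge0 // ltW // (le_lt_trans _ ltM) // f_ni // ltW.
- move=> x /[!inE] /=; rewrite in_itv /= => /andP[x1 x2].
  have x0 : 0 < x by exact: lt_trans x1.
  have := @f_tangent c x _ x0; rewrite lee_fin; lra.
Qed.

Lemma le_chord (a b x : R) : 0 < a -> a < x -> x <= b -> 
  f x <= (f a * (b - x) + f b * (x - a)) / (b - a).
Proof.
move=> a0 ax xb; have x0 : 0 < x by lra.
have b0 : 0 < b by lra.
rewrite ler_pdivlMr; last by lra.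
have h1 := @f_tangent x a x0 a0; have h2 := @f_tangent x b x0 b0.
have := ler_wpM2r (_ : 0 <= b - x) h1; have := ler_wpM2r (_ : 0 <= x - a) h2.
move=> /(_ ltac:(lra)) h3 /(_ ltac:(lra)) h4.
lra.
Qed.

(** The function lies below its chord. *)
Lemma area_trapezoid (a b : R) : 0 < a -> a < b ->
  (area a b <= ((b - a) * ((f a + f b) / 2))%:E)%E.
Proof.
move=> a0 ab; have b0 : 0 < b by lra.
have -> : ((b - a) * ((f a + f b) / 2))%:E =
   (\int[mu]_(x in `]a, b]) ((f a * b - f b * a) / (b - a) + ((f b - f a) / (b - a)) * x)%R%:E)%E.
  by rewrite integral_affine //; congr (_%:E); field; lra.
apply: ge0_le_integral => //.
- move=> x /=; rewrite in_itv /= => /andP[ax xb].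
  by rewrite lee_fin f_ge0 // (lt_trans a0).
- by apply: measurable_decreasing_itv; exact: ltW.
- apply/measurable_EFinP; apply: measurable_funTS; apply: continuous_measurable_fun => x.
  by apply: cvgD; [exact: cvg_cst|apply: cvgMr; exact: cvg_id].
- move=> x /=; rewrite in_itv /= => /andP[ax xb]; rewrite lee_fin.
  apply: (le_trans (le_chord a0 ax xb)); rewrite le_eqVlt; apply/orP; left; apply/eqP.
  by field; lra.
Qed.

End convex.
End area.

(** * Riemann sums against areas *)

Section riemann_sums.
Context {R : realType}.
Local Notation mu := (@lebesgue_measure R).
Variable f : R -> R.
Hypothesis f_ge0 : forall x : R, 0 < x -> 0 <= f x.
Hypothesis f_ni : forall x y : R, 0 < x -> x <= y -> f y <= f x.
Local Notation area := (area f).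
Local Notation area_oo := (area_oo f).

Lemma pow2_gt (x : R) : exists n, x < 2 ^+ n.
Proof.
exists (Num.truncn x).+1; apply: (lt_le_trans (truncnS_gt x)).
by rewrite -natrX ler_nat ltnW // ltn_expl.
Qed.

Lemma area0_le (y : R) (B : \bar R) : 0 < y ->
  (forall n, (area (y / 2 ^+ n) y <= B)%E) -> (area 0 y <= B)%E.
Proof.
move=> y0 le; pose E n : set R := `]y / 2 ^+ n, y]%classic.
have pos n : 0 < y / 2 ^+ n by rewrite divr_gt0 // exprn_gt0.
have bigE : `]0, y]%classic = \bigcup_n E n.
  apply/seteqP; split=> x /=.
    rewrite in_itv /= => /andP[x0 xy]; have [n lt] := pow2_gt (y / x).
    exists n => //; rewrite /E /= in_itv /= xy andbT.
    by rewrite ltr_pdivrMr ?exprn_gt0 // mulrC -ltr_pdivrMr.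
  move=> [n _]; rewrite /E /= !in_itv /= => /andP[x1 ->]; rewrite andbT.
  exact: lt_trans x1.
have cv : (\int[mu]_(x in E n) (f x)%:E)%E @[n --> \oo] -->
    (\int[mu]_(x in \bigcup_n E n) (f x)%:E)%E.
  apply: ge0_nondecreasing_set_cvg_integral.
  - apply/nondecreasing_seqP => n; apply/subsetPset => x.
    rewrite /E /= !in_itv /= => /andP[x1 ->]; rewrite andbT; apply: le_lt_trans x1.
    by rewrite ler_pM2l // lef_pV2 ?posrE ?exprn_gt0 // ler_eXn2l // ltr1n.
  - by move=> n; exact: measurable_itv.
  - by move=> n; apply: (measurable_decreasing_itv f_ni); exact: ltW.
  - move=> n x; rewrite /E /= in_itv /= => /andP[x1 _].
    by rewrite lee_fin f_ge0 // (lt_trans _ x1).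
rewrite /area bigE -(cvg_lim _ cv) //.
apply: lime_le; first by apply/cvg_ex; eexists; exact: cv.
by near=> n; exact: le.
Unshelve. all: by end_near. Qed.

Lemma area_oo_le (y : R) (B : \bar R) : 0 < y ->
  (forall n, (area y (y * 2 ^+ n) <= B)%E) -> (area_oo y <= B)%E.
Proof.
move=> y0 le; pose E n : set R := `]y, y * 2 ^+ n]%classic.
have bigE : `]y, +oo[%classic = \bigcup_n E n.
  apply/seteqP; split=> x /=.
    rewrite in_itv /= andbT => yx; have [n lt] := pow2_gt (x / y).
    exists n => //; rewrite /E /= in_itv /= yx /=.
    by rewrite mulrC -ler_pdivrMr // ltW.
  by move=> [n _]; rewrite /E /= !in_itv /= andbT => /andP[x1 _].
have cv : (\int[mu]_(x in E n) (f x)%:E)%E @[n --> \oo] -->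
    (\int[mu]_(x in \bigcup_n E n) (f x)%:E)%E.
  apply: ge0_nondecreasing_set_cvg_integral.
  - apply/nondecreasing_seqP => n; apply/subsetPset => x.
    rewrite /E /= !in_itv /= => /andP[-> x1] /=; apply: (le_trans x1).
    by rewrite ler_pM2l // ler_eXn2l // ltr1n.
  - by move=> n; exact: measurable_itv.
  - by move=> n; apply: (measurable_decreasing_itv f_ni); exact: ltW.
  - move=> n x; rewrite /E /= in_itv /= => /andP[x1 _].
    by rewrite lee_fin f_ge0 // (lt_trans _ x1).
rewrite /area_oo bigE -(cvg_lim _ cv) //.
apply: lime_le; first by apply/cvg_ex; eexists; exact: cv.
by near=> n; exact: le.
Unshelve. all: by end_near. Qed.

(** Dyadic intervals: on the one from y / 2^(n+1) to y / 2^n the function is at most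
f y + (n + 1) c, and the series of (n + 1) / 2^(n+1) has sum 2.  This covers a logarithmic
singularity, for which halving the argument costs a constant. *)
Lemma area_near0 (y c : R) : 0 < y -> 0 <= c ->
  (forall x, 0 < x -> f (x / 2) <= f x + c) ->
  (area 0 y <= (y * (f y + 2 * c))%:E)%E.
Proof.
move=> y0 c0 half; apply: area0_le => // n.
have pos m : 0 < y / 2 ^+ m by rewrite divr_gt0 // exprn_gt0.
have fn m : f (y / 2 ^+ m) <= f y + m%:R * c.
  elim: m => [|m IH]; first by rewrite expr0 divr1 mul0r addr0.
  rewrite exprSr invfM mulrA; apply: (le_trans (half _ (pos m))).
  by rewrite -[m.+1%:R]natr1 mulrDl mul1r addrA lerD2r.
(* Closed form of the partial sums of the series of (i + 1) / 2^(i + 1). *)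
have /le_trans : (area (y / 2 ^+ n) y <=
    (y * ((1 - 2^-1 ^+ n) * f y + (2 - (n%:R + 2) * 2^-1 ^+ n) * c))%:E)%E.
  elim: n => [|n IH].
    by rewrite !expr0 divr1 /area (_ : `]y, y]%classic = set0) ?integral_set0 ?set_itvE // lee_fin; lra.
  have le1 : y / 2 ^+ n.+1 <= y / 2 ^+ n.
    by rewrite ler_pM2l // lef_pV2 ?posrE ?exprn_gt0 // ler_eXn2l // ltr1n.
  have le2 : y / 2 ^+ n <= y.
    by rewrite ler_pdivrMr ?exprn_gt0 // ler_peMr ?(ltW y0) // exprn_ege1 // ler1n.
  rewrite (area_split f_ge0 f_ni (ltW (pos n.+1)) le1 le2).
  apply: (le_trans (leeD (area_le f_ge0 f_ni (pos n.+1) le1) IH)).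
  rewrite -EFinD lee_fin -!exprVn exprS.
  have := fn n.+1; rewrite -exprVn exprS -[n.+1%:R]natr1; set q := 2^-1 ^+ n.
  have q0 : 0 < q by rewrite exprn_gt0 // invr_gt0.
  move=> fle; have yq0 : 0 <= y * q by rewrite mulr_ge0 // ltW.
  have := ler_wpM2l yq0 fle; set F := f _; set m := n%:R.
  lra.
apply; rewrite lee_fin ler_wpM2l ?(ltW y0) //.
have q0 : 0 <= 2^-1 ^+ n :> R by rewrite exprn_ge0 // invr_ge0.
have fy := f_ge0 y0; have h1 := mulr_ge0 q0 fy.
have h2 : 0 <= (n%:R + 2) * 2^-1 ^+ n * c by rewrite !mulr_ge0 // addr_ge0.
lra.
Qed.

(** Dyadic intervals again: their contributions halve at each step. *)
Lemma area_tail (y c : R) : 0 < y -> 0 <= c ->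
  (forall x, 0 < x -> f x <= c / x ^+ 2) ->
  (area_oo y <= (2 * c / y)%:E)%E.
Proof.
move=> y0 c0 fle; apply: area_oo_le => // n.
have pos m : 0 < y * 2 ^+ m by rewrite mulr_gt0 // exprn_gt0.
have /le_trans : (area y (y * 2 ^+ n) <= (2 * c / y * (1 - 2^-1 ^+ n))%:E)%E.
  elim: n => [|n IH].
    by rewrite !expr0 mulr1 /area (_ : `]y, y]%classic = set0) ?integral_set0 ?set_itvE // subrr mulr0.
  have le1 : y * 2 ^+ n <= y * 2 ^+ n.+1.
    by rewrite ler_pM2l // ler_eXn2l // ltr1n.
  have le2 : y <= y * 2 ^+ n by rewrite ler_peMr ?(ltW y0) // exprn_ege1 // ler1n.
  rewrite (area_split f_ge0 f_ni (ltW y0) le2 le1).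
  apply: (le_trans (leeD IH (area_le f_ge0 f_ni (pos n) le1))).
  rewrite -EFinD lee_fin exprVn exprVn exprS.
  have w0 : 0 <= y * (2 * 2 ^+ n) - y * 2 ^+ n by have := pos n; lra.
  apply: (le_trans (lerD (lexx _) (ler_wpM2l w0 (fle _ (pos n))))).
  rewrite le_eqVlt; apply/orP; left; apply/eqP; field.
  by rewrite !gt_eqF ?exprn_gt0.
apply; rewrite lee_fin -[leRHS]mulr1; apply: ler_wpM2l.
  by rewrite divr_ge0 ?mulr_ge0 // ltW.
by rewrite lerBlDr lerDl exprn_ge0 // invr_ge0.
Qed.

Lemma riemann_lower (la : R) N : 0 < la ->
  ((la * \sum_(k < N) f (k.+1%:R * la))%:E <= area 0 (N%:R * la))%E.
Proof.
move=> la0; elim: N => [|N IH].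
  by rewrite big_ord0 mulr0 (area_ge0 f_ge0).
have n0 : 0 <= N%:R * la by rewrite mulr_ge0 // ltW.
have le1 : N%:R * la <= N.+1%:R * la by rewrite ler_pM2r // ler_nat.
rewrite (area_split f_ge0 f_ni (lexx 0) n0 le1) big_ord_recr /= mulrDr EFinD.
apply: leeD => //; apply: le_trans (area_ge f_ge0 f_ni n0 le1).
by have -> : N.+1%:R * la - N%:R * la = la by rewrite -[N.+1%:R]natr1; ring.
Qed.

Lemma riemann_upper (la : R) N : 0 < la ->
  (area la (N.+1%:R * la) <= (la * \sum_(k < N) f (k.+1%:R * la))%:E)%E.
Proof.
move=> la0; elim: N => [|N IH].
  by rewrite big_ord0 mulr0 mul1r /area (_ : `]la, la]%classic = set0) ?integral_set0 ?set_itvE.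
have n0 : 0 < N.+1%:R * la by rewrite mulr_gt0.
have le1 : N.+1%:R * la <= N.+2%:R * la by rewrite ler_pM2r // ler_nat.
have le0 : la <= N.+1%:R * la by rewrite ler_peMl ?(ltW la0) // ler1n.
rewrite (area_split f_ge0 f_ni (ltW la0) le0 le1) big_ord_recr /= mulrDr EFinD.
apply: leeD => //; apply: (le_trans (area_le f_ge0 f_ni n0 le1)).
by have -> : N.+2%:R * la - N.+1%:R * la = la by rewrite -[N.+2%:R]natr1; ring.
Qed.

Section convex.
Variable slope : R -> R.
Hypothesis f_tangent : forall c x : R, 0 < c -> 0 < x -> f c - slope c * (x - c) <= f x.

(** Cells are centred at the points of the sum, so the first half cell is left over;
it accounts for the term (la / 2) f (la / 2). *)
Lemma riemann_lower_convex (la : R) N : 0 < la ->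
  ((la / 2 * f (la / 2) + la * \sum_(k < N) f (k.+1%:R * la))%:E <=
     area 0 (la / 2 + N%:R * la))%E.
Proof.
move=> la0; have la20 : 0 < la / 2 by rewrite divr_gt0.
elim: N => [|N IH].
  rewrite big_ord0 mulr0 mul0r !addr0 -[X in (X * _)%:E]subr0.
  exact: (area_ge f_ge0 f_ni (lexx 0) (ltW la20)).
have n0 : 0 <= la / 2 + N%:R * la by rewrite addr_ge0 ?mulr_ge0 // ltW.
have le1 : la / 2 + N%:R * la <= la / 2 + N.+1%:R * la.
  by rewrite lerD2l ler_pM2r // ler_nat.
rewrite (area_split f_ge0 f_ni (lexx 0) n0 le1) big_ord_recr /= mulrDr addrA EFinD.
apply: leeD => //; have lt : la / 2 < N.+1%:R * la.
  have : 0 <= N%:R * la by rewrite mulr_ge0 // ltW.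
  by rewrite -[N.+1%:R]natr1 mulrDl mul1r; lra.
have := area_midpoint f_ge0 f_ni f_tangent la20 lt.
have -> : 2 * (la / 2) = la by field.
have -> : N.+1%:R * la - la / 2 = la / 2 + N%:R * la by rewrite -[N.+1%:R]natr1; field.
by rewrite [N.+1%:R * la + la / 2]addrC.
Qed.

Lemma riemann_upper_convex (la : R) N : 0 < la ->
  (area la (N.+1%:R * la) <=
     (la * (\sum_(k < N.+1) f (k.+1%:R * la) - f la / 2))%:E)%E.
Proof.
move=> la0.
have : (area la (N.+1%:R * la) <= (la * (\sum_(k < N.+1) f (k.+1%:R * la)
     - f la / 2 - f (N.+1%:R * la) / 2))%:E)%E.
  elim: N => [|N IH].
    rewrite big_ord1 /= !mul1r /area (_ : `]la, la]%classic = set0) ?set_itvE // integral_set0.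
    by rewrite (_ : f la - f la / 2 - f la / 2 = 0) ?mulr0 //; lra.
  have n0 : 0 < N.+1%:R * la by rewrite mulr_gt0.
  have lt1 : N.+1%:R * la < N.+2%:R * la by rewrite ltr_pM2r // ltr_nat.
  have le0 : la <= N.+1%:R * la by rewrite ler_peMl ?(ltW la0) // ler1n.
  rewrite (area_split f_ge0 f_ni (ltW la0) le0 (ltW lt1)) big_ord_recr /=.
  apply: (le_trans (leeD IH (area_trapezoid f_ge0 f_ni f_tangent n0 lt1))).
  rewrite -EFinD lee_fin le_eqVlt; apply/orP; left; apply/eqP.
  rewrite -[N.+2%:R]natr1; set S := \sum_(k < N.+1) _.
  by field.
move/le_trans; apply; rewrite lee_fin ler_wpM2l ?(ltW la0) //.
have : 0 <= f (N.+1%:R * la) by apply: f_ge0; rewrite mulr_gt0.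
lra.
Qed.

End convex.
End riemann_sums.

(** * The logarithm of the generating function *)

Section log_singularity.
Context {R : realType}.
Implicit Types x y c : R.

Lemma ln_le_sub1 x : 0 < x -> ln x <= x - 1.
Proof. by move=> x0; rewrite -{1}[x](addrNK 1) addrC le_ln1Dx //; lra. Qed.

Definition one_sub_exp x : R := 1 - expR (- x).

Lemma one_sub_exp_gt0 x : 0 < x -> 0 < one_sub_exp x.
Proof. by move=> x0; rewrite subr_gt0 expR_lt1 oppr_lt0. Qed.

Lemma one_sub_exp_lt1 x : one_sub_exp x < 1.
Proof. by rewrite /one_sub_exp ltrBlDr ltrDl expR_gt0. Qed.

Lemma one_sub_exp_le x y : x <= y -> one_sub_exp x <= one_sub_exp y.
Proof. by move=> xy; rewrite lerD2l lerN2 ler_expR lerN2. Qed.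

Lemma one_sub_expE x : one_sub_exp x = (expR x - 1) / expR x.
Proof. by rewrite /one_sub_exp expRN; field; rewrite gt_eqF ?expR_gt0. Qed.

Lemma expR_sub1_gt0 x : 0 < x -> 0 < expR x - 1.
Proof. by move=> x0; rewrite subr_gt0 expR_gt1. Qed.

Lemma expRN_le x : 0 < x -> expR (- x) <= (expR x - 1)^-1.
Proof.
move=> x0; rewrite expRN lef_pV2 ?posrE ?expR_gt0 ?expR_sub1_gt0 //.
by rewrite lerBlDr lerDl.
Qed.

Lemma inv_expR_sub1_le x : 0 < x -> (expR x - 1)^-1 <= x^-1.
Proof.
move=> x0; rewrite lef_pV2 ?posrE ?expR_sub1_gt0 //.
by have := expR_ge1Dx x; lra.
Qed.

Lemma inv_expR_sub1_le_sq x : 0 < x -> (expR x - 1)^-1 <= 2 / x ^+ 2.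
Proof.
move=> x0; rewrite -[2]invrK -invfM lef_pV2 ?posrE ?expR_sub1_gt0 //; last first.
  by rewrite mulr_gt0 ?invr_gt0 ?exprn_gt0.
by have := expR_ge1Dxn 1 (ltW x0); rewrite mulrC; rewrite (_ : 2`! = 2%N) //; lra.
Qed.

(** The convex function L with a logarithmic singularity at 0. *)
Definition logsing x : R := - ln (one_sub_exp x).

Lemma logsing_ge0 x : 0 < x -> 0 <= logsing x.
Proof. by move=> x0; rewrite oppr_ge0 ln_le0 // ltW // one_sub_exp_lt1. Qed.

Lemma logsing_ni x y : 0 < x -> x <= y -> logsing y <= logsing x.
Proof.
move=> x0 xy; have y0 := lt_le_trans x0 xy.
by rewrite lerN2 ler_ln ?posrE ?one_sub_exp_gt0 // one_sub_exp_le.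
Qed.

(** By ln z <= z - 1; the slope at c is - 1 / (exp c - 1). *)
Lemma logsing_tangent c x : 0 < c -> 0 < x ->
  logsing c - (expR c - 1)^-1 * (x - c) <= logsing x.
Proof.
move=> c0 x0; have uc := one_sub_exp_gt0 c0; have ux := one_sub_exp_gt0 x0.
have : logsing c - logsing x = ln (one_sub_exp x / one_sub_exp c).
  by rewrite ln_div ?posrE // /logsing; lra.
have := ln_le_sub1 (divr_gt0 ux uc).
have ec := expR_sub1_gt0 c0.
have E : one_sub_exp x / one_sub_exp c - 1 = (1 - expR (c - x)) / (expR c - 1).
  rewrite one_sub_expE one_sub_expE expRB; field.
  by rewrite !gt_eqF ?expR_gt0.
rewrite E; have : (1 - expR (c - x)) / (expR c - 1) <= (expR c - 1)^-1 * (x - c).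
  rewrite mulrC ler_wpM2l ?invr_ge0 ?(ltW ec) //.
  by have := expR_ge1Dx (c - x); lra.
lra.
Qed.

(** From 1 - exp (- x) = (1 - exp (- x / 2)) (1 + exp (- x / 2)). *)
Lemma logsing_half x : 0 < x -> logsing (x / 2) <= logsing x + ln 2.
Proof.
move=> x0; have x20 : 0 < x / 2 by rewrite divr_gt0.
have u2 := one_sub_exp_gt0 x20; have ux := one_sub_exp_gt0 x0.
suff : ln (one_sub_exp x) <= ln (2 * one_sub_exp (x / 2)).
  by rewrite lnM ?posrE // /logsing; lra.
rewrite ler_ln ?posrE ?mulr_gt0 //.
have -> : one_sub_exp x = one_sub_exp (x / 2) * (1 + expR (- (x / 2))).
  rewrite /one_sub_exp; have -> : - x = - (x / 2) + - (x / 2) by field.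
  by rewrite expRD; ring.
rewrite mulrC ler_wpM2r ?(ltW u2) //.
have : expR (- (x / 2)) <= 1 by rewrite expR_le1 oppr_le0 ltW.
lra.
Qed.

Lemma logsing_le x : 0 < x -> logsing x <= (expR x - 1)^-1.
Proof.
move=> x0; have ux := one_sub_exp_gt0 x0; rewrite /logsing -lnV ?posrE //.
apply: (le_trans (ln_le_sub1 _)); first by rewrite invr_gt0.
rewrite one_sub_expE le_eqVlt; apply/orP; left; apply/eqP; field.
by rewrite !gt_eqF ?expR_gt0 ?expR_sub1_gt0.
Qed.

Lemma logsing_ge_ln x : 0 < x -> - ln x <= logsing x.
Proof.
move=> x0; rewrite lerN2 ler_ln ?posrE ?one_sub_exp_gt0 //.
by rewrite /one_sub_exp; have := expR_ge1Dx (- x); lra.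
Qed.

Lemma logsing_le_ln x : 0 < x -> logsing x <= x - ln x.
Proof.
move=> x0; have ux := one_sub_exp_gt0 x0.
suff : ln (x * expR (- x)) <= ln (one_sub_exp x).
  by rewrite lnM ?posrE ?expR_gt0 // expRK /logsing; lra.
rewrite ler_ln ?posrE ?mulr_gt0 ?expR_gt0 // one_sub_expE expRN.
rewrite ler_wpM2r ?invr_ge0 ?expR_ge0 //.
by have := expR_ge1Dx x; lra.
Qed.

End log_singularity.

Section log_generating_function.
Context {R : realType}.
Local Notation mu := (@lebesgue_measure R).
Variables (phi : R -> R) (b0 M : R) (m : nat).
Hypothesis b0_gt0 : 0 < b0.
Hypothesis phi_ge : forall s, 0 <= s <= 1 -> b0 <= phi s.
Hypothesis phi_mono : forall s t : R, 0 <= s <= t -> t <= 1 -> phi s <= phi t.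
Hypothesis phi1 : phi 1 = 1.
Hypothesis phi_lip : forall s t : R, 0 <= s <= t -> t <= 1 ->
  phi t - phi s <= M * (t - s).

Definition logphi (x : R) : R := - ln (phi (one_sub_exp x)).

Lemma one_sub_exp01 x : 0 < x :> R -> 0 <= one_sub_exp x <= 1.
Proof. by move=> x0; rewrite !ltW ?one_sub_exp_gt0 ?one_sub_exp_lt1. Qed.

Lemma phi_one_sub_exp_gt0 x : 0 < x -> 0 < phi (one_sub_exp x).
Proof. by move=> x0; apply: lt_le_trans b0_gt0 (phi_ge _); exact: one_sub_exp01. Qed.

Lemma lipschitz_ge0 : 0 <= M.
Proof.
have h01 : 0 <= (0 : R) <= 1 by rewrite lexx ler01.
by have := phi_lip h01 (lexx 1); have := phi_mono h01 (lexx 1); lra.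
Qed.

Lemma logphi_ge0 x : 0 < x -> 0 <= logphi x.
Proof.
move=> x0; rewrite oppr_ge0 ln_le0 // -phi1 phi_mono //.
exact: one_sub_exp01.
Qed.

Lemma logphi_ni x y : 0 < x -> x <= y -> logphi y <= logphi x.
Proof.
move=> x0 xy; have y0 := lt_le_trans x0 xy.
have /andP[x1 _] := one_sub_exp01 x0; have /andP[_ y1] := one_sub_exp01 y0.
by rewrite lerN2 ler_ln ?posrE ?phi_one_sub_exp_gt0 // phi_mono // x1 one_sub_exp_le.
Qed.

Lemma logphi_le x : 0 < x -> logphi x <= - ln b0.
Proof.
move=> x0; rewrite lerN2 ler_ln ?posrE ?phi_one_sub_exp_gt0 //.
by apply: phi_ge; exact: one_sub_exp01.
Qed.

(** By ln z <= z - 1, the Lipschitz bound and the lower bound on [phi]. *)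
Lemma logphi_sub x y : 0 < x -> x <= y ->
  logphi x - logphi y <= M / b0 * ((y - x) * expR (- x)).
Proof.
move=> x0 xy; have y0 := lt_le_trans x0 xy.
have px := phi_one_sub_exp_gt0 x0; have py := phi_one_sub_exp_gt0 y0.
have -> : logphi x - logphi y = ln (phi (one_sub_exp y) / phi (one_sub_exp x)).
  by rewrite ln_div ?posrE // /logphi; lra.
apply: (le_trans (ln_le_sub1 (divr_gt0 py px))).
have -> : phi (one_sub_exp y) / phi (one_sub_exp x) - 1 =
  (phi (one_sub_exp y) - phi (one_sub_exp x)) / phi (one_sub_exp x).
  by rewrite mulrBl divff // gt_eqF.
have /andP[x1 _] := one_sub_exp01 x0; have /andP[_ y1] := one_sub_exp01 y0.
have le1 : phi (one_sub_exp y) - phi (one_sub_exp x) <=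
    M * (one_sub_exp y - one_sub_exp x).
  by apply: phi_lip; rewrite ?x1 ?one_sub_exp_le.
have le2 : one_sub_exp y - one_sub_exp x <= (y - x) * expR (- x).
  rewrite /one_sub_exp; have -> : - y = - x + (x - y) by ring.
  rewrite expRD; have := expR_ge1Dx (x - y); have := expR_gt0 (- x).
  set e := expR (- x); set g := expR (x - y); nra.
rewrite ler_pdivrMr // (le_trans le1) //.
have h : 0 <= (y - x) * expR (- x) by rewrite mulr_ge0 ?expR_ge0 // subr_ge0.
have pb := phi_ge (one_sub_exp01 x0).
apply: (le_trans (ler_wpM2l lipschitz_ge0 le2)).
set W := (y - x) * _ in h *; set ph := phi _ in pb *.
have -> : M / b0 * W * ph = (M * W) * (ph / b0) by ring.
apply: ler_peMr; first exact: mulr_ge0 lipschitz_ge0 h.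
by rewrite ler_pdivlMr // mul1r.
Qed.

Lemma logphi_tail x : 0 < x -> logphi x <= M / b0 * expR (- x).
Proof.
move=> x0; have px := phi_one_sub_exp_gt0 x0; have /andP[x1 x2] := one_sub_exp01 x0.
rewrite /logphi -lnV ?posrE //.
apply: (le_trans (ln_le_sub1 _)); first by rewrite invr_gt0.
have -> : (phi (one_sub_exp x))^-1 - 1 = (phi 1 - phi (one_sub_exp x)) / phi (one_sub_exp x).
  by rewrite phi1; field; rewrite gt_eqF.
have := phi_lip (one_sub_exp01 x0) (lexx 1).
have -> : 1 - one_sub_exp x = expR (- x) by rewrite /one_sub_exp; ring.
move=> le1; rewrite ler_pdivrMr // (le_trans le1) //.
have h : 0 <= M * expR (- x) by rewrite mulr_ge0 ?expR_ge0 // lipschitz_ge0.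
have pb := phi_ge (one_sub_exp01 x0).
set W := expR _ in h *; set ph := phi _ in pb *.
have -> : M / b0 * W * ph = (M * W) * (ph / b0) by ring.
apply: ler_peMr => //; by rewrite ler_pdivlMr // mul1r.
Qed.

Lemma logphi_tail_sq x : 0 < x -> logphi x <= (2 * (M / b0)) / x ^+ 2.
Proof.
move=> x0; apply: (le_trans (logphi_tail x0)).
rewrite [leRHS](_ : _ = M / b0 * (2 / x ^+ 2)); last by field; rewrite !gt_eqF.
apply: ler_wpM2l; first by rewrite divr_ge0 ?lipschitz_ge0 // ltW.
exact: le_trans (expRN_le x0) (inv_expR_sub1_le_sq x0).
Qed.

Definition logpgf (x : R) : R := m%:R * logsing x + logphi x.

Lemma logpgf_ge0 x : 0 < x -> 0 <= logpgf x.
Proof. by move=> x0; rewrite addr_ge0 ?mulr_ge0 ?logsing_ge0 ?logphi_ge0. Qed.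

Lemma logpgf_ni x y : 0 < x -> x <= y -> logpgf y <= logpgf x.
Proof. by move=> x0 xy; rewrite lerD ?ler_wpM2l ?logsing_ni ?logphi_ni. Qed.

Lemma logpgfE x : 0 < x -> logpgf x = - ln (one_sub_exp x ^+ m * phi (one_sub_exp x)).
Proof.
move=> x0; rewrite lnM ?posrE ?exprn_gt0 ?one_sub_exp_gt0 ?phi_one_sub_exp_gt0 //.
by rewrite lnXn ?one_sub_exp_gt0 // -mulr_natl /logpgf /logsing /logphi; ring.
Qed.

(** Relative changes of the argument control the changes of [logpgf], in spite of its
singularity at 0. *)
Lemma logpgf_sub x y : 0 < x -> x <= y ->
  logpgf x - logpgf y <= (m%:R + M / b0) * ((y - x) / x).
Proof.
move=> x0 xy; have y0 := lt_le_trans x0 xy.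
have yx : 0 <= y - x by rewrite subr_ge0.
have c0 : 0 <= M / b0 by rewrite divr_ge0 ?lipschitz_ge0 // ltW.
have h1 : logsing x - logsing y <= (y - x) / x.
  have := logsing_tangent x0 y0.
  have := ler_wpM2r yx (inv_expR_sub1_le x0); rewrite [x^-1 * _]mulrC; lra.
have h2 : logphi x - logphi y <= M / b0 * ((y - x) / x).
  apply: (le_trans (logphi_sub x0 xy)); rewrite ler_wpM2l // ler_wpM2l //.
  exact: le_trans (expRN_le x0) (inv_expR_sub1_le x0).
have := ler_wpM2l (ler0n R m) h1; rewrite /logpgf; lra.
Qed.

Let KL := area_oo (@logsing R) 0.
Let KQ := area_oo logphi 0.

Lemma logsing_tail_sq x : 0 < x :> R -> logsing x <= 2 / x ^+ 2.
Proof. by move=> x0; exact: le_trans (logsing_le x0) (inv_expR_sub1_le_sq x0). Qed.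

Lemma ln2_ge0 : 0 <= ln 2 :> R.
Proof. by rewrite ln_ge0 // ler1n. Qed.

Lemma logphi_half x : 0 < x -> logphi (x / 2) <= logphi x + (- ln b0).
Proof.
move=> x0; have := logphi_le (divr_gt0 x0 (ltr0Sn R 1)); have := logphi_ge0 x0; lra.
Qed.

Lemma lnb0_ge0 : 0 <= - ln b0.
Proof. exact: le_trans (logphi_ge0 ltr01) (logphi_le ltr01). Qed.

Lemma area_logsing_fin : KL \is a fin_num.
Proof.
rewrite ge0_fin_numE; last exact: (area_oo_ge0 logsing_ge0).
rewrite /KL (area_oo_split logsing_ge0 logsing_ni (lexx 0) ler01) lte_add_pinfty //.
  exact: le_lt_trans (area_near0 logsing_ge0 logsing_ni ltr01 ln2_ge0 logsing_half) (ltry _).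
exact: le_lt_trans (area_tail logsing_ge0 logsing_ni ltr01 (ler0n _ 2) logsing_tail_sq) (ltry _).
Qed.

Let tail_ge0 : 0 <= 2 * (M / b0).
Proof. by rewrite mulr_ge0 ?divr_ge0 ?lipschitz_ge0 // ltW. Qed.

Lemma area_logphi_fin : KQ \is a fin_num.
Proof.
rewrite ge0_fin_numE; last exact: (area_oo_ge0 logphi_ge0).
rewrite /KQ (area_oo_split logphi_ge0 logphi_ni (lexx 0) ler01) lte_add_pinfty //.
  exact: le_lt_trans (area_near0 logphi_ge0 logphi_ni ltr01 lnb0_ge0 logphi_half) (ltry _).
exact: le_lt_trans (area_tail logphi_ge0 logphi_ni ltr01 tail_ge0 logphi_tail_sq) (ltry _).
Qed.

Definition logpgf_integral : R := fine (area_oo logpgf 0).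

Lemma logpgf_integralE : logpgf_integral = m%:R * fine KL + fine KQ.
Proof.
rewrite -[RHS]/(fine (m%:R * fine KL + fine KQ)%:E) EFinD EFinM !fineK ?area_logsing_fin ?area_logphi_fin //.
congr fine; rewrite /KL /KQ /area_oo -ge0_integralZl //.
- rewrite -ge0_integralD //.
  + by move=> x /=; rewrite in_itv /= andbT => x0; rewrite lee_fin mulr_ge0 ?logsing_ge0.
  + apply: emeasurable_funM => //.
    exact: (measurable_decreasing logsing_ni).
  + by move=> x /=; rewrite in_itv /= andbT => x0; rewrite lee_fin logphi_ge0.
  + exact: (measurable_decreasing logphi_ni).
- exact: (measurable_decreasing logsing_ni).
- by move=> x /=; rewrite in_itv /= andbT => x0; rewrite lee_fin logsing_ge0.
Qed.

Lemma sum_logpgf N (la : R) : \sum_(k < N) logpgf (k.+1%:R * la) =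
  m%:R * \sum_(k < N) logsing (k.+1%:R * la) + \sum_(k < N) logphi (k.+1%:R * la).
Proof. by rewrite mulr_sumr -big_split. Qed.

(** Monotonicity suffices for the bounded part [logphi].  For [logsing] the midpoint
rule leaves a half cell at 0, of area at least (la / 2) ln (2 / la); this is the origin
of the term (m / 2) ln la. *)
Lemma sum_logpgf_le N (la : R) : 0 < la ->
  \sum_(k < N) logpgf (k.+1%:R * la) <= logpgf_integral / la + m%:R / 2 * ln la.
Proof.
move=> la0; have la20 : 0 < la / 2 by rewrite divr_gt0.
have n0 : 0 <= la / 2 + N%:R * la by rewrite addr_ge0 ?mulr_ge0 // ltW.
have n1 : 0 <= N%:R * la by rewrite mulr_ge0 // ltW.
have := le_trans (riemann_lower_convex logsing_ge0 logsing_ni logsing_tangent N la0)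
  (area_le_oo logsing_ge0 logsing_ni (lexx 0) n0).
rewrite -/KL -(fineK area_logsing_fin) lee_fin => hL.
have := le_trans (riemann_lower logphi_ge0 logphi_ni N la0)
  (area_le_oo logphi_ge0 logphi_ni (lexx 0) n1).
rewrite -/KQ -(fineK area_logphi_fin) lee_fin => hQ.
have := logsing_ge_ln la20; rewrite ln_div ?posrE // => hl.
have h2 := ln2_ge0.
rewrite sum_logpgf logpgf_integralE.
set SL := \sum_(k < N) logsing _ in hL *; set SQ := \sum_(k < N) logphi _ in hQ *.
have -> : (m%:R * fine KL + fine KQ) / la + m%:R / 2 * ln la =
   (m%:R * (fine KL + la / 2 * ln la) + fine KQ) / la by field; rewrite gt_eqF.
rewrite ler_pdivlMr // (_ : _ * la = m%:R * (la * SL) + la * SQ); last by ring.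
apply: lerD => //; apply: ler_wpM2l => //; have : la / 2 * (- ln la) <= la / 2 * logsing (la / 2).
  by rewrite ler_wpM2l ?(ltW la20) //; lra.
lra.
Qed.

(** The trapezoid rule counts half of the first point, and [area_near0] allows for a whole
cell at 0, hence together half a cell of height - ln la up to a
constant.  The last part of the error is due to the tail beyond the last point. *)
Lemma sum_logpgf_ge N (la Lam : R) : 0 < la <= Lam ->
  logpgf_integral / la + m%:R / 2 * ln la
   - (m%:R * (Lam / 2 + 2 * ln 2) + 3 * (- ln b0)
      + (4 * m%:R + 4 * (M / b0)) / (N.+1%:R * la ^+ 2)) <=
  \sum_(k < N.+1) logpgf (k.+1%:R * la).
Proof.
move=> /andP[la0 laL]; have n0 : 0 < N.+1%:R * la by rewrite mulr_gt0.
have le1 : la <= N.+1%:R * la by rewrite ler_peMl ?(ltW la0) // ler1n.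
have EL := area_oo_split logsing_ge0 logsing_ni (lexx 0) (ltW la0).
rewrite (area_oo_split logsing_ge0 logsing_ni (ltW la0) le1) -/KL in EL.
have hL : (KL <= (la * (logsing la + 2 * ln 2))%:E +
   ((la * (\sum_(k < N.+1) logsing (k.+1%:R * la) - logsing la / 2))%:E +
    (2 * 2 / (N.+1%:R * la))%:E))%E.
  rewrite EL; apply: leeD.
    exact: (area_near0 logsing_ge0 logsing_ni la0 ln2_ge0 logsing_half).
  apply: leeD; first exact: (riemann_upper_convex logsing_ge0 logsing_ni logsing_tangent).
  exact: (area_tail logsing_ge0 logsing_ni n0 (ler0n _ 2) logsing_tail_sq).
have EQ := area_oo_split logphi_ge0 logphi_ni (lexx 0) (ltW la0).
rewrite (area_oo_split logphi_ge0 logphi_ni (ltW la0) le1) -/KQ in EQ.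
have hQ : (KQ <= (la * (logphi la + 2 * (- ln b0)))%:E +
   ((la * (\sum_(k < N) logphi (k.+1%:R * la)))%:E +
    (2 * (2 * (M / b0)) / (N.+1%:R * la))%:E))%E.
  rewrite EQ; apply: leeD.
    exact: (area_near0 logphi_ge0 logphi_ni la0 lnb0_ge0 logphi_half).
  apply: leeD; first exact: (riemann_upper logphi_ge0 logphi_ni).
  exact: (area_tail logphi_ge0 logphi_ni n0 tail_ge0 logphi_tail_sq).
move: hL hQ; rewrite -(fineK area_logsing_fin) -(fineK area_logphi_fin) -!EFinD !lee_fin.
rewrite sum_logpgf logpgf_integralE.
have : \sum_(k < N) logphi (k.+1%:R * la) <= \sum_(k < N.+1) logphi (k.+1%:R * la).
  by rewrite [leRHS]big_ord_recr /= lerDl logphi_ge0.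
set SL := \sum_(k < N.+1) logsing _; set SQ := \sum_(k < N.+1) logphi _.
set SQ' := \sum_(k < N) _ => hS hL hQ.
have hl := logsing_le_ln la0; have hb := logphi_le la0.
have kL : fine KL / la <= SL + (logsing la / 2 + 2 * ln 2) + 4 / (N.+1%:R * la ^+ 2).
  rewrite ler_pdivrMr // (le_trans hL) // le_eqVlt; apply/orP; left; apply/eqP.
  by field; rewrite gt_eqF //= pnatr_eq0.
have kQ : fine KQ / la <= SQ' + (logphi la + 2 * (- ln b0)) + 4 * (M / b0) / (N.+1%:R * la ^+ 2).
  rewrite ler_pdivrMr // (le_trans hQ) // le_eqVlt; apply/orP; left; apply/eqP.
  by field; rewrite !gt_eqF //= pnatr_eq0.
rewrite mulrDl -mulrA.
have kL2 : fine KL / la <= SL + ((Lam - ln la) / 2 + 2 * ln 2) + 4 / (N.+1%:R * la ^+ 2).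
  apply: (le_trans kL); rewrite lerD2r lerD2l lerD2r ler_pM2r ?invr_gt0 //.
  by rewrite (le_trans hl) // lerD2r.
have := ler_wpM2l (ler0n R m) kL2.
rewrite [(4 * m%:R + _) / _]mulrDl.
have -> : 4 * m%:R / (N.+1%:R * la ^+ 2) = m%:R * (4 / (N.+1%:R * la ^+ 2)) by ring.
set tL := 4 / _; set tQ := 4 * _ / _ in kQ *.
lra.
Qed.

End log_generating_function.

(** * Drift parameters with concave reciprocals *)

Section drift_parameters.
Context {R : realType}.
Variable a : nat -> R.
Hypothesis a_gt0 : forall n, (1 <= n)%N -> 0 < a n.
Hypothesis a_lt : forall n, (1 <= n)%N -> a n < 2^-1.
Hypothesis a_ni : forall n, (1 <= n)%N -> a n.+1 <= a n.
Hypothesis inv_concave : concave_seq (fun j => (a j)^-1).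

Lemma a_le i n : (1 <= i <= n)%N -> a n <= a i.
Proof.
move=> /andP[i1]; elim: n => [|n IH]; first by rewrite leqn0 => /eqP i0; move: i1; rewrite i0.
rewrite leq_eqVlt => /predU1P[->//|]; rewrite ltnS => iln.
exact: le_trans (a_ni (leq_trans i1 iln)) (IH iln).
Qed.

(** [step_ratio n = exp (- decay n)] when p n = 1/2 + a n. *)
Definition decay (n : nat) : R := ln ((1 + 2 * a n) / (1 - 2 * a n)).

Lemma a_bounds n : (1 <= n)%N -> [/\ 0 < a n, a n < 2^-1 & a n <= a 1].
Proof. by move=> n1; split; [exact: a_gt0|exact: a_lt|apply: a_le]. Qed.

(** By ln z <= z - 1 for z = 1 - 2 a and for z = 1 / (1 + 2 a). *)
Lemma decay_ge n : (1 <= n)%N -> 4 * a n * (1 - a n) <= decay n.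
Proof.
move=> n1; have [a0 a2 _] := a_bounds n1.
have x0 : 0 < 1 - 2 * a n by lra.
have y0 : 0 < 1 + 2 * a n by lra.
have h1 := ln_le_sub1 x0.
have : 0 < (1 + 2 * a n)^-1 by rewrite invr_gt0.
move=> /ln_le_sub1; rewrite lnV ?posrE // => h2.
rewrite /decay ln_div ?posrE //.
have : (1 + 2 * a n)^-1 <= 1 - 2 * a n + 4 * a n ^+ 2.
  by rewrite -[leLHS]mul1r ler_pdivrMr //; nra.
rewrite expr2; lra.
Qed.

Let slack : R := 1 - 2 * a 1.

Lemma slack_gt0 : 0 < slack.
Proof. by have := a_lt (leqnn 1); rewrite /slack; lra. Qed.

Lemma decay_sub i n : (1 <= i <= n)%N -> decay i - decay n <= 4 / slack * (a i - a n).
Proof.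
move=> /andP[i1 iln]; have n1 := leq_trans i1 iln.
have [ai0 ai2 ai1] := a_bounds i1; have [an0 an2 an1] := a_bounds n1.
have le : a n <= a i by apply: a_le; rewrite i1.
have g0 := slack_gt0.
have pi : 0 < (1 + 2 * a i) / (1 - 2 * a i) by apply: divr_gt0; lra.
have pn : 0 < (1 + 2 * a n) / (1 - 2 * a n) by apply: divr_gt0; lra.
rewrite /decay -ln_div ?posrE //.
apply: (le_trans (ln_le_sub1 (divr_gt0 pi pn))).
have -> : (1 + 2 * a i) / (1 - 2 * a i) / ((1 + 2 * a n) / (1 - 2 * a n)) - 1 =
   4 * (a i - a n) / ((1 - 2 * a i) * (1 + 2 * a n)).
  by field; rewrite !gt_eqF //=; lra.
rewrite [leRHS]mulrAC ler_wpM2l //; first by lra.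
rewrite lef_pV2 ?posrE //; last by apply: mulr_gt0; lra.
by rewrite /slack; nra.
Qed.

Lemma decay_le n : (1 <= n)%N -> decay n <= 4 * a n / (1 - 2 * a n).
Proof.
move=> n1; have [a0 a2 _] := a_bounds n1.
have pn : 0 < (1 + 2 * a n) / (1 - 2 * a n) by apply: divr_gt0; lra.
apply: (le_trans (ln_le_sub1 pn)); rewrite le_eqVlt; apply/orP; left; apply/eqP.
by field; lra.
Qed.

Lemma decay_le_slack n : (1 <= n)%N -> decay n <= 4 / slack * a n.
Proof.
move=> n1; have [a0 a2 a1] := a_bounds n1; have g0 := slack_gt0.
apply: (le_trans (decay_le n1)); rewrite [leRHS]mulrAC ler_wpM2l //; first by lra.
by rewrite lef_pV2 ?posrE //; rewrite /slack; lra.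
Qed.

Lemma decay_ni i n : (1 <= i <= n)%N -> decay n <= decay i.
Proof.
move=> /andP[i1 iln]; have n1 := leq_trans i1 iln.
have [ai0 ai2 ai1] := a_bounds i1; have [an0 an2 an1] := a_bounds n1.
have le : a n <= a i by apply: a_le; rewrite i1.
rewrite ler_ln ?posrE; try by apply: divr_gt0; lra.
rewrite ler_pdivrMr; last by lra.
by rewrite mulrAC ler_pdivlMr; nra.
Qed.

(** Concavity of 1 / a: the slope of the chord from [i] to [n] is at most that of the
chord from 1 to [i], and 1 / a is positive at 1. *)
Lemma inv_a_chord i n : (1 <= i)%N -> (i < n)%N ->
  ((a n)^-1 - (a i)^-1) * (i.-1)%:R <= (a i)^-1 * (n - i)%:R.
Proof.
pose g j := (a j)^-1; pose D j := g j.+1 - g j.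
have D_ni j k : (1 <= j <= k)%N -> D k <= D j.
  move=> /andP[j1]; elim: k => [|k IH]; first by rewrite leqn0 => /eqP j0; move: j1; rewrite j0.
  rewrite leq_eqVlt => /predU1P[->//|]; rewrite ltnS => jk.
  by apply: le_trans (IH jk); apply: inv_concave; exact: leq_trans jk.
move=> i1 iltn.
have up k : (1 <= i)%N -> g (i + k)%N - g i <= k%:R * D i.
  move=> _; elim: k => [|k IH]; first by rewrite addn0 subrr mul0r.
  have := D_ni i (i + k)%N; rewrite i1 leq_addr => /(_ isT).
  rewrite /D -addnS in IH * => h; rewrite -[k.+1%:R]natr1; move: h; rewrite addnS; lra.
have low k : (k.+1 <= i)%N -> k%:R * D i <= g i - g (i - k)%N.
  elim: k => [|k IH] ki; first by rewrite subn0 subrr mul0r.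
  have E : (i - k.+1).+1 = (i - k)%N by rewrite -subSn // ltnW.
  have hD : D i <= g (i - k)%N - g (i - k.+1)%N.
    by rewrite -E; apply: D_ni; rewrite leq_subr subn_gt0 ki.
  by have := IH (ltnW ki); rewrite -[k.+1%:R]natr1; lra.
have h1 := up (n - i)%N i1; rewrite subnKC ?(ltnW iltn) // in h1.
have h2 := low i.-1; rewrite prednK // leqnn in h2; have {}h2 := h2 isT.
have E1 : (i - i.-1 = 1)%N by rewrite -{1}(prednK i1) subSnn.
rewrite E1 in h2.
have g1 : 0 < g 1%N by rewrite invr_gt0 a_gt0.
have n0 : 0 <= (n - i)%:R :> R by []. have m0 : 0 <= (i.-1)%:R :> R by [].
have := ler_wpM2l m0 h1; have := ler_wpM2l n0 h2; rewrite -/(g n) -/(g i).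
set N1 := (n - i)%:R in n0 *; set M1 := (i.-1)%:R in m0 *.
have := mulr_ge0 n0 (ltW g1); lra.
Qed.

End drift_parameters.

(** * Comparison of gap probabilities with the explicit terms *)

Section comparison.
Context {R : realType}.
Variable a : nat -> R.
Hypothesis a_gt0 : forall n, (1 <= n)%N -> 0 < a n.
Hypothesis a_lt : forall n, (1 <= n)%N -> a n < 2^-1.
Hypothesis a_ni : forall n, (1 <= n)%N -> a n.+1 <= a n.
Hypothesis inv_concave : concave_seq (fun j => (a j)^-1).
Local Notation decay := (decay a).

Variables (H : R -> R) (K e c D E : R).
Hypothesis K_ge0 : 0 <= K.
Hypothesis e_ge0 : 0 <= e.
Hypothesis c_ge0 : 0 <= c.
Hypothesis E_ge0 : 0 <= E.
Hypothesis H_gt0 : forall x : R, 0 < x -> 0 < H x.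
Hypothesis H_ni : forall x y : R, 0 < x -> x <= y -> H y <= H x.
Hypothesis H_sub : forall x y : R, 0 < x -> x <= y -> H x - H y <= c * ((y - x) / x).
Hypothesis H_up : forall N (la : R), 0 < la ->
  \sum_(k < N) H (k.+1%:R * la) <= K / la + e * ln la.
Hypothesis H_low : forall N (la : R), 0 < la <= decay 1 ->
  K / la + e * ln la - (D + E / (N.+1%:R * la ^+ 2)) <= \sum_(k < N.+1) H (k.+1%:R * la).

(** [- ln (gap_prob 1 k)], the site at distance [j + 1] from the target being [k - j]. *)
Definition exponent (k : nat) : R := \sum_(j < k) H (j.+1%:R * decay (k - j)).
Definition model_term (n : nat) : R := expR (- (K / (4 * a n)) - e * ln (a n)).

Let slack : R := 1 - 2 * a 1.
Let slack_gt0 : 0 < slack := slack_gt0 a_lt.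
Let bounds n := @a_bounds R a a_gt0 a_lt a_ni n.

Lemma decay_gt0 n : (1 <= n)%N -> 0 < decay n.
Proof.
move=> n1; have [a0 a2 _] := bounds n1.
by apply: lt_le_trans (decay_ge a_gt0 a_lt a_ni n1); rewrite mulr_gt0 //; lra.
Qed.

Lemma decay_ge2 n : (1 <= n)%N -> 2 * a n <= decay n.
Proof.
move=> n1; have [a0 a2 _] := bounds n1.
by apply: le_trans (decay_ge a_gt0 a_lt a_ni n1); nra.
Qed.

(** [decay n] is 4 a n up to a relative error of order a n, so K / decay n is
K / (4 a n) up to a bounded error. *)
Lemma K_decay_le n : (1 <= n)%N -> K / decay n <= K / (4 * a n) + K / 2.
Proof.
move=> n1; have [a0 a2 _] := bounds n1; have d0 := decay_gt0 n1.
rewrite -mulrDr ler_wpM2l //.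
have le := decay_ge a_gt0 a_lt a_ni n1.
have p0 : 0 < 4 * a n * (1 - a n) by rewrite mulr_gt0 //; lra.
apply: (le_trans (y := (4 * a n * (1 - a n))^-1)); first by rewrite lef_pV2 ?posrE.
rewrite -[leLHS]mul1r ler_pdivrMr //.
have -> : ((4 * a n)^-1 + 2^-1) * (4 * a n * (1 - a n)) = (1 - a n) * (1 + 2 * a n).
  by field; rewrite gt_eqF.
nra.
Qed.

Lemma K_decay_ge n : (1 <= n)%N -> K / (4 * a n) - K / 2 <= K / decay n.
Proof.
move=> n1; have [a0 a2 _] := bounds n1; have d0 := decay_gt0 n1.
rewrite -mulrBr ler_wpM2l //; have x0 : 0 < 1 - 2 * a n by lra.
apply: (le_trans (y := (4 * a n / (1 - 2 * a n))^-1)); last first.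
  by rewrite lef_pV2 ?posrE ?divr_gt0 ?mulr_gt0 // (decay_le a_gt0 a_lt a_ni).
rewrite le_eqVlt; apply/orP; left; apply/eqP; by field; rewrite !gt_eqF.
Qed.

Lemma exponent_le k : exponent k <=
  K / (4 * a k.+1) + e * ln (a k.+1) + (K / 2 + e * ln (4 / slack)).
Proof.
have [a0 a2 _] := bounds (ltn0Sn k); have d0 := decay_gt0 (ltn0Sn k).
have le1 : exponent k <= \sum_(j < k) H (j.+1%:R * decay k.+1).
  apply: ler_sum => j _; apply: H_ni; first by rewrite mulr_gt0.
  rewrite ler_wpM2l // (decay_ni a_gt0 a_lt a_ni) // subn_gt0 ltn_ord /=.
  exact: leq_trans (leq_subr _ _) (leqnSn k).
apply: (le_trans le1); apply: (le_trans (H_up k d0)).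
have g4 : 0 < 4 / slack by rewrite divr_gt0.
have : ln (decay k.+1) <= ln (4 / slack) + ln (a k.+1).
  rewrite -lnM ?posrE // ler_ln ?posrE ?(mulr_gt0 g4 a0) //.
  exact: (decay_le_slack a_gt0 a_lt a_ni (ltn0Sn k)).
move=> /(ler_wpM2l e_ge0); have := K_decay_le (ltn0Sn k); lra.
Qed.

Lemma model_term_le k :
  model_term k.+1 <= expR (K / 2 + e * ln (4 / slack)) * expR (- exponent k).
Proof. by rewrite -expRD ler_expR; have := exponent_le k; lra. Qed.

Lemma a_window i n : (1 <= i)%N -> (i < n)%N ->
  (a i - a n) * (i.-1)%:R <= a n * (n - i)%:R.
Proof.
move=> i1 iltn; have n1 := leq_trans i1 (ltnW iltn).
have [ai0 _ _] := bounds i1; have [an0 _ _] := bounds n1.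
have := inv_a_chord a_gt0 inv_concave i1 iltn.
have p0 : 0 < a i * a n by rewrite mulr_gt0.
move=> /(ler_wpM2l (ltW p0)).
have -> : a i * a n * (((a n)^-1 - (a i)^-1) * (i.-1)%:R) = (a i - a n) * (i.-1)%:R.
  by field; rewrite !gt_eqF.
have -> // : a i * a n * ((a i)^-1 * (n - i)%:R) = a n * (n - i)%:R.
  by field; rewrite gt_eqF.
Qed.

Section window.
Variables q k : nat.
Hypothesis q_ge2 : (2 <= q)%N.
Hypothesis qk : (q ^ 4 <= k.+1)%N.

Lemma window_le j : (j < q ^ 2)%N -> (j < k)%N /\ (q ^ 4 <= (k - j).-1 * 2)%N.
Proof.
have h2 : (4 <= q ^ 2)%N by rewrite -[X in (X <= _)%N]/(2 ^ 2)%N leq_exp2r.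
have h : (4 * q ^ 2 <= q ^ 4)%N by rewrite (expnD q 2 2) leq_mul2r h2 orbT.
by move=> jq; split; lia.
Qed.

(** Over a window of q^2 sites before a site beyond q^4, concavity of 1 / a bounds the
relative variation of a by the ratio of the two lengths, up to a
constant. *)
Lemma a_window_le j : (j < q ^ 2)%N ->
  a (k - j) - a k.+1 <= a k.+1 * (2 / q%:R ^+ 2).
Proof.
move=> jq; have [jk q4] := window_le jq; have [an0 _ _] := bounds (ltn0Sn k).
have i1 : (1 <= k - j)%N by rewrite subn_gt0.
have ilt : (k - j < k.+1)%N by rewrite ltnS leq_subr.
have := a_window i1 ilt; have -> : (k.+1 - (k - j) = j.+1)%N by lia.
move=> le; have q0 : 0 < q%:R :> R by rewrite ltr0n (leq_trans _ q_ge2).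
have d0 : 0 <= a (k - j) - a k.+1.
  by rewrite subr_ge0 (a_le a_ni) // i1 ltnW.
have q4' : q%:R ^+ 4 <= ((k - j).-1)%:R * 2 :> R by rewrite -natrX -natrM ler_nat.
have jq' : j.+1%:R <= q%:R ^+ 2 :> R by rewrite -natrX ler_nat.
rewrite mulrA ler_pdivlMr ?exprn_gt0 //.
have h1 := ler_wpM2l d0 q4'; have h2 := ler_wpM2l (ltW an0) jq'.
have q2 : 0 < q%:R ^+ 2 :> R by rewrite exprn_gt0.
rewrite -(ler_pM2r q2) -mulrA -exprD.
have -> : (2 + 2 = 4)%N by [].
set Q4 := _ ^+ 4 in h1 *; set Q2 := _ ^+ 2 in h2 *; lra.
Qed.

Lemma exponent_ge_head N : (N <= k)%N ->
  \sum_(j < N) H (j.+1%:R * decay (k - j)) <= exponent k.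
Proof.
move=> Nk; rewrite /exponent (big_ord_widen k (fun j => H (j.+1%:R * decay (k - j)))) //.
rewrite big_mkcond /=; apply: ler_sum => j _; case: ifP => // _.
by apply/ltW/H_gt0; rewrite mulr_gt0 // decay_gt0 // subn_gt0.
Qed.

(** The window of q^2 sites is short enough for the decays to be replaced by the
last one: each of the q^2 terms changes by O(1 / q^2).  It is long enough for the
truncated Riemann sum to miss only a bounded part of K / decay, because
q^2 (decay k.+1)^2 is bounded below. *)
Lemma exponent_ge_slow : (a k.+1)^-1 <= q.+1%:R ->
  K / (4 * a k.+1) + e * ln (a k.+1)
    - (K / 2 + D + E + 4 * (c / slack)) <= exponent k.
Proof.
move=> gq; have [a0 a2 _] := bounds (ltn0Sn k); have d0 := decay_gt0 (ltn0Sn k).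
have q0 : 0 < q%:R :> R by rewrite ltr0n (leq_trans _ q_ge2).
have q20 : 0 < q%:R ^+ 2 :> R by rewrite exprn_gt0.
have Nk : (q ^ 2 <= k)%N.
  have := @window_le (q ^ 2).-1; rewrite prednK ?expn_gt0 ?(leq_trans _ q_ge2) //.
  by case.
have EN : ((q ^ 2).-1.+1 = q ^ 2)%N by rewrite prednK // expn_gt0 (leq_trans _ q_ge2).
apply: le_trans (exponent_ge_head Nk).
have diff (j : 'I_(q ^ 2)) : H (j.+1%:R * decay k.+1) - 4 * (c / slack) / q%:R ^+ 2 <=
    H (j.+1%:R * decay (k - j)).
  have [jk _] := window_le (ltn_ord j).
  have kj1 : (1 <= k - j <= k.+1)%N by rewrite subn_gt0 jk (leq_trans (leq_subr _ _)).
  have dle := decay_ni a_gt0 a_lt a_ni kj1.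
  have x0 : 0 < j.+1%:R * decay k.+1 by rewrite mulr_gt0.
  have xy : j.+1%:R * decay k.+1 <= j.+1%:R * decay (k - j) by rewrite ler_wpM2l.
  have := H_sub x0 xy; rewrite -mulrBr.
  have -> : j.+1%:R * (decay (k - j) - decay k.+1) / (j.+1%:R * decay k.+1) =
      (decay (k - j) - decay k.+1) / decay k.+1.
    by field; rewrite gt_eqF //= pnatr_eq0.
  have le3 : (decay (k - j) - decay k.+1) / decay k.+1 <= 4 / slack / q%:R ^+ 2.
    rewrite ler_pdivrMr //.
    apply: (le_trans (decay_sub a_gt0 a_lt a_ni kj1)).
    apply: (le_trans (y := 4 / slack * (a k.+1 * (2 / q%:R ^+ 2)))).
      by rewrite ler_wpM2l ?divr_ge0 ?(ltW slack_gt0) // a_window_le.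
    rewrite [leRHS](_ : _ = 4 / slack * (decay k.+1 / q%:R ^+ 2)); last by ring.
    rewrite (_ : a k.+1 * _ = 2 * a k.+1 / q%:R ^+ 2); last by ring.
    apply: ler_wpM2l; first by rewrite divr_ge0 // ltW.
    by rewrite ler_wpM2r ?invr_ge0 ?(ltW q20) // decay_ge2.
  have := ler_wpM2l c_ge0 le3.
  rewrite (_ : c * (4 / slack / q%:R ^+ 2) = 4 * (c / slack) / q%:R ^+ 2); last by ring.
  lra.
apply: le_trans (ler_sum _ (fun j _ => diff j)).
rewrite sumrB sumr_const card_ord -[_ / q%:R ^+ 2 *+ _]mulr_natr natrX divfK ?gt_eqF //.
have dd : 0 < decay k.+1 <= decay 1 by rewrite d0 (decay_ni a_gt0 a_lt a_ni).
have := H_low (q ^ 2).-1 dd; rewrite EN natrX.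
have hE : E / (q%:R ^+ 2 * decay k.+1 ^+ 2) <= E.
  rewrite -[leRHS]mulr1 ler_wpM2l //.
  rewrite -[leRHS]invr1 lef_pV2 ?posrE ?mulr_gt0 ?exprn_gt0 //.
  rewrite -exprMn expr_ge1 ?mulr_ge0 ?(ltW d0) //.
  have := decay_ge2 (ltn0Sn k); have : q.+1%:R <= 2 * q%:R :> R.
    by rewrite -natrM ler_nat mul2n -addnn -addn1 leq_add2l (leq_trans _ q_ge2).
  have : 1 <= q.+1%:R * a k.+1.
    by rewrite -ler_pdivrMr // mul1r.
  move=> h1 h2 h3; have := ler_wpM2r (ltW a0) h2; have := ler_wpM2l (ltW q0) h3; lra.
have hl : ln (a k.+1) <= ln (decay k.+1).
  by rewrite ler_ln ?posrE //; have := decay_ge2 (ltn0Sn k); lra.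
have := ler_wpM2l e_ge0 hl; have := K_decay_ge (ltn0Sn k).
lra.
Qed.

(** The frogs of the last q sites need at most q steps to reach the target, which is
within the range 1 / a on which a frog succeeds with probability bounded
below. *)
Lemma exponent_ge_fast : q.+1%:R <= (a k.+1)^-1 ->
  q%:R * H (8 / slack) <= exponent k.
Proof.
move=> gq; have [a0 a2 _] := bounds (ltn0Sn k).
have q0 : 0 < q%:R :> R by rewrite ltr0n (leq_trans _ q_ge2).
have qq : (q <= q ^ 2)%N by rewrite -[X in (X <= _)%N]expn1 leq_pexp2l // (leq_trans _ q_ge2).
have Nk : (q <= k)%N.
  have [|] := @window_le q.-1; rewrite prednK ?(leq_trans _ q_ge2) //.
apply: le_trans (exponent_ge_head Nk).
rewrite mulr_natl -[X in _ *+ X]card_ord -sumr_const; apply: ler_sum => j _.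
have jq : (j < q ^ 2)%N by exact: leq_trans (ltn_ord j) qq.
have [jk _] := window_le jq; have kj1 : (1 <= k - j)%N by rewrite subn_gt0.
have [b0 _ _] := bounds kj1.
apply: H_ni; first by rewrite mulr_gt0 // decay_gt0.
have le1 : a (k - j) <= 2 * a k.+1.
  have := a_window_le jq.
  have : 2 / q%:R ^+ 2 <= 1 :> R.
    rewrite ler_pdivrMr ?exprn_gt0 // mul1r -natrX ler_nat.
    by rewrite (leq_trans q_ge2).
  by move=> /(ler_wpM2l (ltW a0)); lra.
have le2 := decay_le_slack a_gt0 a_lt a_ni kj1.
have le3 : j.+1%:R * a k.+1 <= 1.
  rewrite -ler_pdivlMr // mul1r (le_trans _ gq) // ler_nat.
  exact: leq_trans (ltn_ord j) (leqnSn q).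
have g4 : 0 <= 4 / slack by rewrite divr_ge0 // ltW.
have j0 : 0 <= j.+1%:R :> R by [].
apply: (le_trans (ler_wpM2l j0 le2)).
have h := ler_wpM2l j0 le1.
have -> : j.+1%:R * (4 / slack * a (k - j)) = 4 / slack * (j.+1%:R * a (k - j)) by ring.
have -> : 8 / slack = 4 / slack * 2 by rewrite mulrAC; congr (_ / _); ring.
by apply: ler_wpM2l => //; lra.
Qed.

End window.

Lemma fourth_root n : (16 <= n)%N -> exists q, [/\ (2 <= q)%N, (q ^ 4 <= n)%N & (n < q.+1 ^ 4)%N].
Proof.
move=> n16; have ex : exists q, (q ^ 4 <= n)%N by exists 0%N.
have ub q : (q ^ 4 <= n)%N -> (q <= n)%N.
  by apply: leq_trans; case: q => // q; rewrite -[X in (X <= _)%N]expn1 leq_pexp2l.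
case: (ex_maxnP ex ub) => q q4 max; exists q; split=> //.
  by apply: max; exact: n16.
by rewrite ltnNge; apply/negP => /max; rewrite ltnn.
Qed.

Lemma exponent_bound : exists2 C, 0 <= C & forall k, (15 <= k)%N ->
  expR (- exponent k) <= C * (model_term k.+1 + (k.+1%:R ^+ 2)^-1).
Proof.
pose C1 := expR (K / 2 + D + E + 4 * (c / slack)).
pose eta := H (8 / slack).
have eta0 : 0 < eta by apply: H_gt0; rewrite divr_gt0.
pose C2 := 8`!%:R * 2 ^+ 8 / eta ^+ 8.
have C1_ge0 : 0 <= C1 by exact: expR_ge0.
have C2_ge0 : 0 <= C2 by rewrite divr_ge0 ?mulr_ge0 ?exprn_ge0 // ltW.
exists (C1 + C2) => [|k k15]; first exact: addr_ge0.
have [q [q2 qk kq]] := @fourth_root k.+1 k15.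
have t0 : 0 <= model_term k.+1 by exact: expR_ge0.
have s0 : 0 <= (k.+1%:R ^+ 2)^-1 :> R by rewrite invr_ge0 exprn_ge0.
have key (u v w z : R) : 0 <= u -> 0 <= v -> 0 <= w -> 0 <= z ->
    u * w <= (u + v) * (w + z) by nra.
case: (lerP (a k.+1)^-1 q.+1%:R) => [slow|/ltW fast].
  have le : expR (- exponent k) <= C1 * model_term k.+1.
    by rewrite -expRD ler_expR; have := exponent_ge_slow q2 qk slow; lra.
  exact: le_trans le (key _ _ _ _ C1_ge0 C2_ge0 t0 s0).
have le : expR (- exponent k) <= C2 * (k.+1%:R ^+ 2)^-1.
  apply: (le_trans (y := expR (- (q%:R * eta)))).
    by rewrite ler_expR lerN2; exact: exponent_ge_fast.
  have q0 : 0 < q%:R :> R by rewrite ltr0n (leq_trans _ q2).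
  have x0 : 0 < q%:R * eta by rewrite mulr_gt0.
  (* The term x^8 / 8! of exp x: as q^4 is of order k, this is of order k^2. *)
  have := expR_ge1Dxn 7 (ltW x0); set F := 8`!%:R => hF.
  have F0 : 0 < F by rewrite /F ltr0n fact_gt0.
  have k2 : 0 < k.+1%:R ^+ 2 :> R by rewrite exprn_gt0.
  rewrite expRN -[C2]invrK -invfM lef_pV2 ?posrE ?expR_gt0 //; last first.
    by rewrite mulr_gt0 // invr_gt0 /C2 divr_gt0 ?mulr_gt0 ?exprn_gt0.
  have hk : k.+1%:R ^+ 2 <= 2 ^+ 8 * q%:R ^+ 8 :> R.
    rewrite -exprMn -!natrM -!natrX ler_nat.
    apply: (leq_trans (n := (q.+1 ^ 4) ^ 2)); first by rewrite leq_exp2r // ltnW.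
    rewrite -expnM leq_exp2r // mul2n -addnn -addn1 leq_add2l; exact: leq_trans q2.
  have h8 : (q%:R * eta) ^+ 8 / F <= expR (q%:R * eta).
    by apply: le_trans hF; rewrite lerDr.
  apply: le_trans h8.
  have -> : C2^-1 * k.+1%:R ^+ 2 = (k.+1%:R ^+ 2 * eta ^+ 8) / (F * 2 ^+ 8).
    by rewrite /C2 -/F; field; rewrite !gt_eqF.
  rewrite ler_pdivrMr ?mulr_gt0 ?exprn_gt0 // exprMn.
  rewrite (_ : _ / F * _ = 2 ^+ 8 * q%:R ^+ 8 * eta ^+ 8); last by field; rewrite gt_eqF.
  by rewrite ler_wpM2r // exprn_ge0 // ltW.
rewrite [C1 + C2]addrC [model_term _ + _]addrC.
exact: le_trans le (key _ _ _ _ C2_ge0 C1_ge0 s0 t0).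
Qed.

Lemma sum_inv_sq_le M : \sum_(k < M) (k.+1%:R ^+ 2)^-1 <= 2 :> R.
Proof.
suff H0 : \sum_(k < M.+1) (k.+1%:R ^+ 2)^-1 <= 2 - (M.+1%:R)^-1 :> R.
  apply: (le_trans (y := \sum_(k < M.+1) (k.+1%:R ^+ 2)^-1)).
    by rewrite [leRHS]big_ord_recr /= lerDl invr_ge0 exprn_ge0.
  by apply: (le_trans H0); rewrite lerBlDr lerDl invr_ge0.
elim: M => [|M IH]; first by rewrite big_ord1 /= expr1n invr1; lra.
rewrite big_ord_recr /=; apply: (le_trans (lerD IH (lexx _))).
have m0 : 0 < M.+1%:R :> R by [].
rewrite -[M.+2%:R]natr1; set x := M.+1%:R in m0 *.
have x1 : 0 < x + 1 by lra.
have -> : 2 - x^-1 + ((x + 1) ^+ 2)^-1 = 2 - (x + 1)^-1 - (x * (x + 1) ^+ 2)^-1.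
  by field; rewrite !gt_eqF.
by rewrite gerDl oppr_le0 invr_ge0 mulr_ge0 ?exprn_ge0 // ltW.
Qed.
End comparison.

(** * The transience criterion *)

Lemma nneseries_unbounded (R : realType) (t : nat -> R) : (forall n, (1 <= n)%N -> 0 <= t n) ->
  (\sum_(1 <= n <oo) (t n)%:E = +oo)%E <->
  ~ exists C, forall M, \sum_(k < M) t k.+1 <= C.
Proof.
move=> t0.
have partial M : (\sum_(1 <= n < M.+1) (t n)%:E = (\sum_(k < M) t k.+1)%:E)%E.
  by rewrite sumEFin big_add1 /= big_mkord.
split=> [E [C le]|H].
  have : (\sum_(1 <= n <oo) (t n)%:E <= C%:E)%E.
    apply: lime_le; first by apply: is_cvg_nneseries => n n1 _; rewrite lee_fin t0.
    near=> M; have M0 : (0 < M)%N by near: M; exists 1%N.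
    by rewrite -(prednK M0) partial lee_fin.
  by rewrite E.
apply: contrapT => ne; apply: H.
have s0 : (0 <= \sum_(1 <= n <oo) (t n)%:E)%E.
  by apply: nneseries_ge0 => n n1 _; rewrite lee_fin t0.
have fin : (\sum_(1 <= n <oo) (t n)%:E)%E \is a fin_num.
  by rewrite ge0_fin_numE // ltey; apply/eqP.
exists (fine (\sum_(1 <= n <oo) (t n)%:E)%E) => M.
rewrite -lee_fin fineK // -partial; apply: nneseries_lim_ge => n n1 _.
by rewrite lee_fin t0.
Unshelve. all: by end_near. Qed.

Lemma exp_decay (R : realType) (a : nat -> R) n : 0 < a n < 2^-1 ->
  (1 - (2^-1 + a n)) / (2^-1 + a n) = expR (- decay a n).
Proof.
move=> /andP[a0 a2]; have q0 : 0 < (1 + 2 * a n) / (1 - 2 * a n) by apply: divr_gt0; lra.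
rewrite /decay -lnV ?posrE // lnK ?posrE ?invr_gt0 //.
by field; lra.
Qed.

Theorem theorem3p1 (disp : measure_display) (T : measurableType disp)
    (R : realType) (P : probability T R)
    (X : nat -> {RV P >-> nat}) (left : nat -> nat -> nat -> {RV P >-> bool})
    (p a : nat -> R) (d : nat)
    (model : nonhomogeneous_frog_model X left p)
    (X_identically_distributed : forall j, (1 <= j)%N ->
       distribution P (X j) = distribution P (X 1%N))
    (X_integrable : ('E_P[fun w => (X 1%N w)%:R] < +oo)%E)
    (pE : forall j, (1 <= j)%N -> p j = 2^-1 + a j)
    (g_concave : concave_seq (fun j => (a j)^-1))
    (d_attained : (0 < P [set w | X 1%N w = d])%E)
    (d_min : forall j, (0 < P [set w | X 1%N w = j])%E -> (d <= j)%N) :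
  transient X left <->
  (\sum_(1 <= n <oo)
     (expR (- (frog_K (X 1%N) / (4 * a n))) / (a n `^ (d%:R / 2)))%:E
   = +oo)%E.
Proof.
have a_gt0 n : (1 <= n)%N -> 0 < a n.
  by move=> n1; have := p_gt model n; rewrite pE //; lra.
have a_lt n : (1 <= n)%N -> a n < 2^-1.
  by move=> n1; have := p_lt1 model n; rewrite pE //; lra.
have a_ni n : (1 <= n)%N -> a n.+1 <= a n.
  by move=> n1; have := drift_decreasing model n1; rewrite !pE //; lra.
have mX x : measurable [set w | X 1%N w = x] := measurable_nat_preimage (X 1%N) [set x].
pose b0 := mass (X 1%N) d.
have b0_gt0 : 0 < b0 by rewrite -lte_fin -probE.
have m_min x : mass (X 1%N) x != 0 -> (d <= x)%N.
  by move=> x0; apply: d_min; rewrite probE // lte_fin lt_neqAle eq_sym x0 mass_ge0.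
pose phi := reduced_pgf (X 1%N) d.
pose M := fine (mean (X 1%N) (fun x => x%:R)).
have M_fin : mean (X 1%N) (fun x => x%:R) \is a fin_num.
  rewrite ge0_fin_numE; last exact: mean_ge0.
  by rewrite -meanE //; move: X_integrable; rewrite unlock.
have phi_ge s : 0 <= s <= 1 -> b0 <= phi s by exact: reduced_pgf_ge.
have phi_mono s t : 0 <= s <= t -> t <= 1 -> phi s <= phi t by exact: reduced_pgf_mono.
have phi1 : phi 1 = 1 by exact: reduced_pgf1.
have phi_lip s t : 0 <= s <= t -> t <= 1 -> phi t - phi s <= M * (t - s).
  by apply: reduced_pgf_lipschitz; rewrite fineK.
pose H := logpgf phi d.
have pgfE x : 0 < x -> - ln (pgf (X 1%N) (one_sub_exp x)) = H x.
  move=> x0; rewrite /H (logpgfE d b0_gt0 phi_ge x0) (pgf_reduced m_min) //.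
  exact: one_sub_exp01.
have pgf01 x : 0 < x -> 0 < pgf (X 1%N) (one_sub_exp x) < 1.
  move=> x0; apply/andP; split; last first.
    apply: pgf_lt1; last exact: mass0_lt1 model.
    by rewrite ltW ?one_sub_exp_gt0 ?one_sub_exp_lt1.
  rewrite (pgf_reduced m_min) ?one_sub_exp01 // mulr_gt0 //.
    by rewrite exprn_gt0 // one_sub_exp_gt0.
  exact: (phi_one_sub_exp_gt0 b0_gt0 phi_ge x0).
have KE : frog_K (X 1%N) = logpgf_integral phi d.
  rewrite /frog_K /Rintegral /logpgf_integral /area_oo.
  have -> : (\int[lebesgue_measure]_(x in `]0%R, +oo[) (ln (pgf (X 1%N) (1 - expR (- x))))%:E =
     \int[lebesgue_measure]_(x in `]0%R, +oo[) - (H x)%:E)%E.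
    apply: eq_integral => x; rewrite inE /= in_itv /= andbT => x0.
    by rewrite -(pgfE x x0) opprK.
  rewrite integral_ge0N ?fineN ?opprK // => x; rewrite /= in_itv /= andbT => x0.
  by rewrite lee_fin; apply: (logpgf_ge0 d phi_mono phi1 x0).
set K := frog_K (X 1%N) in KE *.
pose e : R := d%:R / 2.
have K_ge0 : 0 <= K.
  rewrite KE; apply: fine_ge0; apply: area_oo_ge0 => // x x0.
  exact: (logpgf_ge0 d phi_mono phi1 x0).
have e_ge0 : 0 <= e by rewrite divr_ge0.
have M_ge : 0 <= M := lipschitz_ge0 phi_mono phi_lip.
have Mb : 0 <= M / b0 by rewrite divr_ge0 // ltW.
have H_gt0 x : 0 < x -> 0 < H x.
  by move=> x0; rewrite -pgfE // oppr_gt0 ln_lt0 // pgf01.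
have H_ni x y : 0 < x -> x <= y -> H y <= H x.
  exact: (logpgf_ni d b0_gt0 phi_ge phi_mono).
have H_sub x y : 0 < x -> x <= y -> H x - H y <= (d%:R + M / b0) * ((y - x) / x).
  exact: (logpgf_sub d b0_gt0 phi_ge phi_mono phi_lip).
have H_up N la : 0 < la -> \sum_(k < N) H (k.+1%:R * la) <= K / la + e * ln la.
  by rewrite KE; exact: (sum_logpgf_le d b0_gt0 phi_ge phi_mono phi1 phi_lip).
have H_low N la : 0 < la <= decay a 1 -> K / la + e * ln la
   - (d%:R * (decay a 1 / 2 + 2 * ln 2) + 3 * (- ln b0)
      + (4 * d%:R + 4 * (M / b0)) / (N.+1%:R * la ^+ 2)) <= \sum_(k < N.+1) H (k.+1%:R * la).
  by rewrite KE; exact: (sum_logpgf_ge d b0_gt0 phi_ge phi_mono phi1 phi_lip).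
have c_ge0 : 0 <= d%:R + M / b0 by rewrite addr_ge0.
have E_ge0 : 0 <= 4 * d%:R + 4 * (M / b0) by rewrite addr_ge0 // mulr_ge0.
have d0 n : (1 <= n)%N -> 0 < decay a n by exact: (@decay_gt0 _ _ a_gt0 a_lt a_ni n).
have ratioE n : (1 <= n)%N -> step_ratio p n = expR (- decay a n).
  by move=> n1; rewrite /step_ratio pE // exp_decay ?a_gt0 ?a_lt.
have gapE k : gap_prob X p 1 k = expR (- exponent a H k).
  have -> : - exponent a H k = \sum_(j < k) - H (j.+1%:R * decay a (k - j)).
    by rewrite /exponent sumrN.
  rewrite expR_sum /gap_prob (reindex_inj rev_ord_inj) /=.
  apply: eq_bigr => j _; have jk := ltn_ord j.
  have -> : (1 + (k - j.+1) = k - j)%N by rewrite add1n subnSK.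
  have -> : (k - (k - j.+1) = j.+1)%N by rewrite subKn.
  have kj : (1 <= k - j)%N by rewrite subn_gt0.
  have x0 : 0 < j.+1%:R * decay a (k - j) by rewrite mulr_gt0 // d0.
  rewrite ratioE // -expRM_natl mulrN -/(one_sub_exp _) -pgfE // opprK lnK // posrE.
  by case/andP: (pgf01 _ x0).
have termE n : (1 <= n)%N ->
    expR (- (K / (4 * a n))) / a n `^ (d%:R / 2) = model_term a K e n.
  move=> n1; rewrite /model_term expRB /powR gt_eqF // a_gt0 //.
rewrite (transient_iff_gap_sum model X_identically_distributed).
rewrite nneseries_unbounded; last first.
  by move=> n n1; rewrite termE // expR_ge0.
have bound1 := model_term_le a_gt0 a_lt a_ni K_ge0 e_ge0 H_ni H_up.
have [C C0 bound2] := exponent_bound a_gt0 a_lt a_ni g_concave K_ge0 e_ge0 c_ge0 E_ge0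
  H_gt0 H_ni H_sub H_low.
apply: not_iff_compat; split=> -[B leB].
  exists (expR (K / 2 + e * ln (4 / (1 - 2 * a 1))) * B) => N.
  apply: (le_trans _ (ler_wpM2l (expR_ge0 _) (leB N))); rewrite mulr_sumr.
  by apply: ler_sum => k _; rewrite termE // gapE.
(* The fifteen first gap probabilities, for which the fourth root of the site is
   below 2, are bounded by 1. *)
exists (15 + C * (B + 2)) => N.
have le k : gap_prob X p 1 k <= (k < 15)%:R + C * (model_term a K e k.+1 + (k.+1%:R ^+ 2)^-1).
  have r0 : 0 <= C * (model_term a K e k.+1 + (k.+1%:R ^+ 2)^-1).
    by rewrite mulr_ge0 // addr_ge0 ?expR_ge0 // invr_ge0 exprn_ge0.
  case: ltnP => [_|k15]; last by rewrite add0r gapE bound2.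
  by rewrite (le_trans (gap_prob_le1 model 1 k)) // lerDl.
apply: (le_trans (ler_sum _ (fun (k : 'I_N) _ => le k))); rewrite big_split /=; apply: lerD.
  have E : (\sum_(k < N) (k < 15) = minn N 15)%N.
    by elim: (N) => [|n IH]; rewrite ?big_ord0 // big_ord_recr /= IH; lia.
  by rewrite -natr_sum ler_nat E geq_minr.
rewrite -mulr_sumr ler_wpM2l // big_split /= lerD ?sum_inv_sq_le //.
apply: le_trans (leB N); apply: ler_sum => k _; by rewrite termE.
Qed.
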